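(* Let $G_{\mathrm{puz}}$ be the ring graph on $V=\mathbb{Z}_n$ (the cycle on $n$ vertices), with parameters $\tau=1$, $\theta=\infty$ and arbitrary $\sigma\ge1$. As $n\to\infty$, $$p_c\log n\to\lambda_\sigma,$$ and there is sharp transition.
   Context: Setting. $G_{\mathrm{puz}}=(V,E_{\mathrm{puz}})$ (the puzzle graph) is a finite connected deterministic graph. $G_{\mathrm{ppl}}=(V,E_{\mathrm{ppl}})$ (the people graph) is the Erdős–Rényi random graph on the same vertex set: each unordered pair of distinct vertices is an edge independently with probability $p$ (which may depend on $n$); $\mathbb{P}_p$ denotes its law. Two vertices $v_1,v_2$ are doubly connected if $\{v_1,v_2\}\in E_{\mathrm{ppl}}\cap E_{\mathrm{puz}}$. For $v\in V$, $S\subset V$, let $\mathrm{coll}(v,S)$ (resp. $\mathrm{link}(v,S)$) be the number of $G_{\mathrm{ppl}}$-neighbors (resp. $G_{\mathrm{puz}}$-neighbors) of $v$ in $S$, not including $v$. Jigsaw percolation with integer parameters $\sigma\ge1$, $\tau\ge1$, $\theta\ge\tau$ ($\theta=\infty$ allowed) is the following discrete-time dynamics on partitions $\mathcal{P}^t=\{W_i^t\}$ of $V$. Given $\mathcal{P}^t$, let $\mathcal{G}_t$ be the graph with vertex set $\mathcal{P}^t$ and unoriented edges between distinct $W_i^t$ and $W_j^t$ such that, for some ordering of the two, at least one of the following holds: (J1) there are doubly connected $v_1\in W_i^t$, $v_2\in W_j^t$; (J2) there is $v_1\in W_i^t$ with $\mathrm{link}(v_1,W_j^t)\ge\theta$;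 (J3) there is $v_1\in W_i^t$ with $\mathrm{coll}(v_1,W_j^t)\ge\sigma$ and $\mathrm{link}(v_1,W_j^t)\ge\tau$. Then $\mathcal{P}^{t+1}$ is obtained by merging all sets of $\mathcal{P}^t$ that lie in the same connected component of $\mathcal{G}_t$. $\mathrm{Solve}$ is the event that, starting from $\mathcal{P}^0$ consisting of all singletons, $\mathcal{P}^t=\{V\}$ for some $t$. The critical probability $p_c$ is defined by $\mathbb{P}_{p_c}(\mathrm{Solve})=\tfrac12$. There is sharp transition if, for any $\epsilon>0$, $\mathbb{P}_{(1-\epsilon)p_c}(\mathrm{Solve})\to0$ and $\mathbb{P}_{(1+\epsilon)p_c}(\mathrm{Solve})\to1$ as $n\to\infty$. For $\sigma\ge1$, $g_\sigma(x)=-\log\mathbb{P}(\mathrm{Poisson}(x)\ge\sigma)$ and $\lambda_\sigma=\int_0^\infty g_\sigma(x)\,dx$. *)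

(* Defs.v *)
From HB Require Import structures.
From mathcomp Require Import all_boot all_order all_algebra.
From mathcomp Require Import all_classical all_reals all_analysis.

Set Implicit Arguments.
Unset Strict Implicit.
Unset Printing Implicit Defensive.

Import Order.TTheory GRing.Theory Num.Theory.
Import numFieldNormedType.Exports.

Section JigsawDynamics.

Local Open Scope set_scope.
Local Open Scope nat_scope.

Variable V : finType.

(* A graph on V is given by its edge set, a subset of [pairs]. *)
Definition pairs : {set {set V}} := [set e : {set V} | #|e| == 2].

Definition nb_neighbors (E : {set {set V}}) (v : V) (S : {set V}) : nat :=
  #|[set w in S | (w != v) && ([set v; w] \in E)]|.

Variables (Epuz : {set {set V}}) (sigma tau : nat).
(* [None] stands for theta = oo. *)
Variable theta : option nat.
Variable Eppl : {set {set V}}.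

Definition coll (v : V) (S : {set V}) : nat := nb_neighbors Eppl v S.
Definition link (v : V) (S : {set V}) : nat := nb_neighbors Epuz v S.

Definition J1 (W W' : {set V}) : bool :=
  [exists v1 in W, exists v2 in W', [set v1; v2] \in Eppl :&: Epuz].

Definition J2 (W W' : {set V}) : bool :=
  if theta is Some th then [exists v1 in W, th <= link v1 W'] else false.

Definition J3 (W W' : {set V}) : bool :=
  [exists v1 in W, (sigma <= coll v1 W') && (tau <= link v1 W')].

(* The adjacency relation of the graph G_t, whose vertices are the members
   of the partition P. *)
Definition piece_adj (P : {set {set V}}) (W W' : {set V}) : bool :=
  [&& W \in P, W' \in P, W != W' &
      [|| J1 W W', J2 W W', J3 W W', J1 W' W, J2 W' W | J3 W' W]].

Definition jigsaw_step (P : {set {set V}}) : {set {set V}} :=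
  [set finset.cover [set W' in P | connect (piece_adj P) W W'] | W in P].

Definition singletons : {set {set V}} := [set [set v] | v : V].

Definition solve : Prop :=
  exists t : nat, iter t jigsaw_step singletons = [set [set: V]].

End JigsawDynamics.

Local Open Scope classical_set_scope.
Local Open Scope ring_scope.

(* Truncation to [0, 1], so that [er_prob p] is a probability for every real
   p, in particular for p = (1 - eps) * p_c and p = (1 + eps) * p_c. *)
Definition edge_prob (R : realType) (p : R) : R := Num.min 1 (Num.max 0 p).

(* The probability that the edge set of the Erdos-Renyi random graph on V
   with edge probability p satisfies A. *)
Definition er_prob (R : realType) (V : finType) (p : R)
    (A : {set {set V}} -> Prop) : R :=
  \sum_(E : {set {set V}} | (E \subset pairs V) && `[< A E >])
    \prod_(e in pairs V)
      (if e \in E then edge_prob p else 1 - edge_prob p).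

Definition solve_prob (R : realType) (V : finType) (Epuz : {set {set V}})
    (sigma tau : nat) (theta : option nat) (p : R) : R :=
  er_prob p (solve Epuz sigma tau theta).

(* If V has at least two elements, Epuz is connected, 1 <= sigma and
   theta = oo, then [solve_prob] is 0 at p = 0, 1 at p = 1, and continuous and
   strictly increasing on [0, 1], so that it takes the value 1/2 exactly once
   and the default value 0 of [xget] is not used. *)
Definition critical_prob (R : realType) (V : finType) (Epuz : {set {set V}})
    (sigma tau : nat) (theta : option nat) : R :=
  xget 0 [set p : R | 0 <= p <= 1 /\
                      solve_prob Epuz sigma tau theta p = 2^-1].

Definition sharp_transition (R : realType) (V : nat -> finType)
    (Epuz : forall n, {set {set V n}})
    (sigma tau : nat) (theta : option nat) : Prop :=
  let pc n : R := critical_prob R (Epuz n) sigma tau theta in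
  forall eps : R, 0 < eps ->
    (solve_prob (Epuz n) sigma tau theta ((1 - eps) * pc n)
       @[n --> \oo] --> (0 : R)) /\
    (solve_prob (Epuz n) sigma tau theta ((1 + eps) * pc n)
       @[n --> \oo] --> (1 : R)).

(* [ordS] is the successor modulo n; this is the n-cycle for 3 <= n. *)
Definition ring_puzzle (n : nat) : {set {set 'I_n}} :=
  [set [set i; ordS i] | i : 'I_n]%SET.

(* The second argument of [poisson_prob] is a dummy. *)
Definition g_ (R : realType) (sigma : nat) (x : R) : \bar R :=
  (- lne (poisson_prob x 0%N [set k | (sigma <= k)%N]))%E.

Definition lambda_ (R : realType) (sigma : nat) : \bar R :=
  (\int[@lebesgue_measure R]_(x in `[0%R, +oo[) g_ sigma x)%E.

(* Main.v *)
(* Put q = - ln (1 - p), so that q ~ p, and let g = g_sigma.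

   Lower bound on p_c: if the puzzle is solved, then for every k <= n some arc
   of length in [k, 2k) is internally spanned (merge pieces two at a time).  In
   the merging tree of an interval of length m, descend into the child longer
   than m - l, with l a small fraction of 1/q, until there is none.  Every
   vertex gap crossed on the way requires, on disjoint sets of pairs, that some
   vertex has sigma people-neighbours in an interval of length m, up to a
   negligible correction; by the BK inequality each gap costs about
   exp (- g (q m)).  The two remaining children are handled by induction, which
   is favourable since g is decreasing, and the tree has boundedly many such
   branchings when m is of order 1/q.  The interval is thus spanned with
   probability at most exp (- (lambda - o(1)) / q), and the union bound over n
   arcs concludes when p < (1 - eps) lambda / ln n.

   Upper bound on p_c: a block of length k ~ (ln n)^3 is filled by growth to the
   right from its first vertex with probability at least
   p^sigma * prod_j exp (- g (q j)) >= p^sigma * exp (- lambda / q), by Harris'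
   inequality.  When p > (1 + eps) lambda / ln n one of the n / k disjoint
   blocks is filled with high probability, and every vertex has sigma
   people-neighbours in every block, so the filled block swallows the ring. *)

Require Import Defs.
From HB Require Import structures.
From mathcomp Require Import all_boot all_order all_algebra.
From mathcomp Require Import all_classical all_reals all_analysis.
From mathcomp Require Import measurable_realfun ring lra zify.

Set Implicit Arguments.
Unset Strict Implicit.
Unset Printing Implicit Defensive.

Import Order.TTheory GRing.Theory Num.Theory.
Import numFieldNormedType.Exports.

Local Open Scope ring_scope.

(** * Bernoulli product measures and the BK inequality *)

(** The induction on intervals carries the bound [expR (alpha * node_count m - slope_sum m)]. The
    slope sum is a Riemann sum for [lam / q]; [alpha] is the price of one union bound over the
    triples [(a, b, d)] telling where a descent ends. It is logarithmic in the interval length, so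
    of order ln ln n, and as [l] and the length are both of order [1 / q] it is paid boundedly
    often: the total is negligible against ln n. The obstacle is the singularity of g at 0: for
    short lengths the main term of a gap cost vanishes and the corrections dominate it. Slopes are
    therefore truncated at argument [h], where the main term is at least [phi sigma h] and the
    corrections amount to a factor [expR rho]; integrability of g at 0 makes the loss small. The
    choice [expR (- q) = 1 - p] makes an edge as likely as a nonzero Poisson(q) variable, so
    binomial and Poisson tails compare with no error beyond a shift by [sigma] trials. Each regime
    is settled on a whole half-line of [p], which both locates [critical_prob] and gives the sharp
    transition. *)

Section BernoulliProduct.
Variables (R : realType) (T : finType).
Implicit Types (w : T -> R) (f g : {set T} -> R) (A B : {set T} -> Prop).

(* A random subset of T contains e with probability w e, independently; wt, Ex
   and Pr are its law, expectation and probability. *)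
Definition wt w (E : {set T}) : R :=
  \prod_e (if e \in E then w e else 1 - w e).
Definition Ex w f : R := \sum_(E : {set T}) wt w E * f E.
Definition Pr w A : R := Ex w (fun E => (`[< A E >])%:R).
Definition proba w := forall e, 0 <= w e <= 1.
Definition upd w e (t : R) : T -> R := fun x => if x == e then t else w x.
Definition increasing A := forall E F : {set T}, E \subset F -> A E -> A F.
Definition nondec f := forall E F : {set T}, E \subset F -> f E <= f F.

Lemma Ex_split w e f :
  Ex w f = \sum_(E : {set T} | e \notin E)
    (\prod_(x | x != e) (if x \in E then w x else 1 - w x)) *
    ((1 - w e) * f E + w e * f (e |: E)).
Proof.
rewrite /Ex (bigID (fun E : {set T} => e \in E)) /=.
rewrite (reindex_onto (fun E => e |: E) (fun E => E :\ e)) /=; last first.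
  by move=> E eE; rewrite finset.setD1K.
rewrite [X in X + _](eq_bigl (fun E : {set T} => e \notin E)); last first.
  move=> E; rewrite !inE eqxx /=; apply/eqP/idP => [<-|eE].
    by rewrite !inE eqxx.
  by rewrite setU1K.
rewrite -big_split /=; apply: eq_bigr => E eE.
rewrite /wt (bigD1 e) //= [X in _ + X * _](bigD1 e) //= !inE eqxx (negbTE eE) /=.
rewrite [X in _ * X * _ + _](eq_bigr (fun x => if x \in E then w x else 1 - w x)).
  by ring.
by move=> x /negbTE xe; rewrite !inE xe.
Qed.

(** Conditioning on [e] is expressed by giving [e] weight 0 and adding it by hand, so every
    induction stays inside one type [T]. *)
Lemma Ex_cond w e f :
  Ex w f = (1 - w e) * Ex (upd w e 0) f
           + w e * Ex (upd w e 0) (fun E => f (e |: E)).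
Proof.
rewrite !(Ex_split _ e) !mulr_sumr -big_split /=; apply: eq_bigr => E eE.
have -> : upd w e 0 e = 0 by rewrite /upd eqxx.
rewrite subr0 !mul1r !mul0r !addr0.
rewrite [X in _ = _ * (X * _) + _](eq_bigr (fun x => if x \in E then w x else 1 - w x)).
  rewrite [X in _ = _ + _ * (X * _)](eq_bigr (fun x => if x \in E then w x else 1 - w x)).
    by ring.
  by move=> x /negbTE xe; rewrite /upd xe.
by move=> x /negbTE xe; rewrite /upd xe.
Qed.

(** Plays the part of an induction on the number of coordinates: it counts the nonzero weights, and
    zeroing one of them is exactly what [Ex_cond] does. *)
Lemma w_ind (P : (T -> R) -> Prop) :
  (forall w, (forall e, w e = 0) -> P w) ->
  (forall w e, P (upd w e 0) -> P w) -> forall w, P w.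
Proof.
move=> P0 PS w.
have [n] := ubnP #|[set e | w e != 0]|; elim: n w => // n IHn w wn.
case: (set_0Vmem [set e | w e != 0]) => [w0|[e]].
  by apply: P0 => e; move/setP/(_ e): w0; rewrite !inE => /negbFE/eqP.
rewrite inE => we; apply: (PS w e); apply: IHn.
rewrite ltnS in wn; apply: leq_trans wn; apply: proper_card.
apply/fintype.properP; split.
  by apply/fintype.subsetP => x; rewrite !inE /upd; case: ifP => //; rewrite eqxx.
by exists e; rewrite !inE // /upd !eqxx.
Qed.

Lemma upd0_proba w e : proba w -> proba (upd w e 0).
Proof. by move=> wP x; rewrite /upd; case: eqP => // _; rewrite lexx ler01. Qed.

Lemma Ex_zero w f : (forall e, w e = 0) -> Ex w f = f finset.set0.
Proof.
move=> w0; rewrite /Ex (bigD1 finset.set0) //= big1 ?addr0.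
  rewrite /wt big1 ?mul1r // => e _; by rewrite inE w0 subr0.
move=> E /set0Pn[e eE]; rewrite /wt (bigD1 e) //= eE w0 !mul0r //.
Qed.

Lemma Ex_cst w c : Ex w (fun=> c) = c.
Proof.
elim/w_ind: w => [w w0|w e IH]; first by rewrite Ex_zero.
by rewrite (Ex_cond _ e) IH; ring.
Qed.

Lemma ExD w f g : Ex w (fun E => f E + g E) = Ex w f + Ex w g.
Proof. by rewrite /Ex -big_split /=; apply: eq_bigr => E _; rewrite mulrDr. Qed.

Lemma ExZ w c f : Ex w (fun E => c * f E) = c * Ex w f.
Proof. by rewrite /Ex mulr_sumr; apply: eq_bigr => E _; rewrite mulrCA. Qed.

Lemma ExB w f g : Ex w (fun E => f E - g E) = Ex w f - Ex w g.
Proof. by rewrite /Ex -sumrB; apply: eq_bigr => E _; rewrite mulrBr. Qed.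

Lemma eq_Ex w f g : f =1 g -> Ex w f = Ex w g.
Proof. by move=> fg; apply: eq_bigr => E _; rewrite fg. Qed.

Lemma wt_ge0 w E : proba w -> 0 <= wt w E.
Proof.
move=> wP; apply: prodr_ge0 => e _; have /andP[w0 w1] := wP e.
by case: ifP => // _; rewrite subr_ge0.
Qed.

Lemma le_Ex w f g : proba w -> (forall E, f E <= g E) -> Ex w f <= Ex w g.
Proof. by move=> wP fg; apply: ler_sum => E _; rewrite ler_wpM2l ?wt_ge0. Qed.

Lemma Ex_ge0 w f : proba w -> (forall E, 0 <= f E) -> 0 <= Ex w f.
Proof. by move=> wP f0; rewrite -(Ex_cst w 0); apply: le_Ex. Qed.

Lemma nondec_add e f : nondec f -> nondec (fun E => f (e |: E)).
Proof. by move=> fm E F EF; apply: fm; apply: finset.setUS. Qed.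

Lemma le_Ex_add w e f : proba w -> nondec f -> Ex w f <= Ex w (fun E => f (e |: E)).
Proof. by move=> wP fm; apply: le_Ex => // E; apply: fm; apply: finset.subsetUr. Qed.

Lemma Ex_homo_w w w' f : proba w -> proba w' -> (forall e, w e <= w' e) ->
  nondec f -> Ex w f <= Ex w' f.
Proof.
elim/w_ind: w' w f => [w' w'0|w' e IH] w f wP w'P ww' fm.
  rewrite (Ex_zero _ w'0) Ex_zero // => e; apply/eqP; rewrite eq_le.
  by have /andP[-> _] := wP e; rewrite -(w'0 e) ww'.
rewrite (Ex_cond w e) (Ex_cond w' e).
have le_upd x : upd w e 0 x <= upd w' e 0 x by rewrite /upd; case: eqP.
have I0 := IH _ _ (upd0_proba e wP) (upd0_proba e w'P) le_upd fm.
have I1 := IH _ _ (upd0_proba e wP) (upd0_proba e w'P) le_upd (nondec_add e fm).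
have I2 := le_Ex_add e (upd0_proba e w'P) fm.
have /andP[w0 w1] := wP e; have := ww' e.
move: I0 I1 I2 w0 w1; set a := Ex _ _; set b := Ex _ _; set c := Ex _ _; set d := Ex _ _.
move: (w e) (w' e) => t t'.
move=> h1 h2 h3 h4 h5 h6.
have : (1 - t) * a + t * c <= (1 - t) * b + t * d.
  by apply: lerD; apply: ler_wpM2l => //; lra.
have : 0 <= (t' - t) * (d - b) by apply: mulr_ge0; lra.
lra.
Qed.

Lemma Harris_Ex w f g : proba w -> nondec f -> nondec g ->
  Ex w f * Ex w g <= Ex w (fun E => f E * g E).
Proof.
elim/w_ind: w f g => [w w0|w e IH] f g wP fm gm; first by rewrite !Ex_zero.
rewrite !(Ex_cond w e).
have wP' := upd0_proba e wP.
have I0 := IH _ _ wP' fm gm.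
have I1 := IH _ _ wP' (nondec_add e fm) (nondec_add e gm).
have J1 := le_Ex_add e wP' fm.
have J2 := le_Ex_add e wP' gm.
have /andP[] := wP e.
move: I0 I1 J1 J2; set a := Ex _ _; set b := Ex _ _; set c := Ex _ _; set d := Ex _ _.
set a' := Ex _ _; set b' := Ex _ _.
move: (w e) => t h1 h2 h3 h4 h5 h6.
have : (1 - t) * (a * b) + t * (d * a') <= (1 - t) * c + t * b'.
  by apply: lerD; apply: ler_wpM2l => //; lra.
(* This is the covariance of the two conditional means as functions of the coordinate [e]: a product
   of two nonnegative increments. *)
have : 0 <= (t * (1 - t)) * ((d - a) * (a' - b)).
  by apply: mulr_ge0; apply: mulr_ge0; lra.
lra.
Qed.

Lemma Pr_ge0 w A : proba w -> 0 <= Pr w A.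
Proof. by move=> wP; apply: Ex_ge0 => // E; rewrite ler0n. Qed.

Lemma Pr_le1 w A : proba w -> Pr w A <= 1.
Proof.
by move=> wP; rewrite -[leRHS](Ex_cst w 1); apply: le_Ex => // E; rewrite lern1 leq_b1.
Qed.

Lemma le_Pr w A B : proba w -> (forall E, A E -> B E) -> Pr w A <= Pr w B.
Proof.
move=> wP AB; apply: le_Ex => // E; rewrite ler_nat; case: asboolP => //= aE.
by case: asboolP => // /(_ (AB _ aE)).
Qed.

Lemma eq_Pr w A B : (forall E, A E <-> B E) -> Pr w A = Pr w B.
Proof. by move=> AB; apply: eq_Ex => E; congr (nat_of_bool _)%:R; apply: asbool_equiv_eq. Qed.

Lemma Pr_True w A : (forall E, A E) -> Pr w A = 1.
Proof.
move=> At; rewrite -[RHS](Ex_cst w); apply: eq_Ex => E.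
by case: asboolP.
Qed.

Lemma nondec_ind A : increasing A -> nondec (fun E => (`[< A E >])%:R).
Proof.
move=> Am E F EF; rewrite ler_nat; case: asboolP => //= aE.
by case: asboolP => // /(_ (Am _ _ EF aE)).
Qed.

Lemma Pr_homo_w w w' A : proba w -> proba w' -> (forall e, w e <= w' e) ->
  increasing A -> Pr w A <= Pr w' A.
Proof. by move=> wP w'P ww' /nondec_ind; apply: Ex_homo_w. Qed.

Lemma Pr_Harris w A B : proba w -> increasing A -> increasing B ->
  Pr w A * Pr w B <= Pr w (fun E => A E /\ B E).
Proof.
move=> wP Am Bm; apply: le_trans (Harris_Ex wP (nondec_ind Am) (nondec_ind Bm)) _.
by apply: le_Ex => // E; rewrite asbool_and -natrM mulnb.
Qed.

Lemma PrU w A B : Pr w (fun E => A E \/ B E) + Pr w (fun E => A E /\ B E) = Pr w A + Pr w B.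
Proof.
rewrite /Pr -!ExD; apply: eq_Ex => E; rewrite -!natrD asbool_or asbool_and.
by case: (asbool _) (asbool _) => [] [].
Qed.

Lemma PrU_le w A B : proba w -> Pr w (fun E => A E \/ B E) <= Pr w A + Pr w B.
Proof. by move=> wP; rewrite -PrU lerDl Pr_ge0. Qed.

Lemma PrC w A : Pr w (fun E => ~ A E) = 1 - Pr w A.
Proof.
rewrite -[1](Ex_cst w) /Pr -ExB; apply: eq_Ex => E.
by rewrite asbool_neg; case: (asbool _); rewrite /= ?subr0 ?subrr.
Qed.

Lemma Pr_exists_le w (I : eqType) (s : seq I) (A : I -> {set T} -> Prop) :
  proba w -> Pr w (fun E => exists2 i, i \in s & A i E) <= \sum_(i <- s) Pr w (A i).
Proof.
move=> wP; elim: s => [|i s IHs].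
  rewrite big_nil -[leRHS](Ex_cst w 0); apply: le_Ex => // E.
  by case: asboolP => //= -[].
rewrite big_cons; apply: le_trans (lerD (lexx _) IHs).
apply: le_trans (PrU_le _ _ wP); apply: le_Pr => // E [j].
by rewrite inE => /orP[/eqP -> | js]; [left | right; exists j].
Qed.

(* The union over all coordinates e of the pairs of families that use e on at
   most one side is what makes the induction close, so the statement is about
   an arbitrary increasing relation D and not only about products. *)
Lemma BK_rel w (D : {set T} -> {set T} -> Prop) : proba w ->
  (forall E, increasing (D E)) -> (forall E, increasing (D ^~ E)) ->
  Pr w (fun E => exists2 F : {set T}, F \subset E & D F (E :\: F)) <=
  Ex w (fun E => Pr w (D E)).
Proof.
elim/w_ind: w D => [w w0|w e IH] D wP Dr Dl.
  rewrite /Pr !Ex_zero // ler_nat; case: asboolP => //= -[F].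
  rewrite finset.subset0 => /eqP -> {F}; rewrite finset.setD0 => D00.
  by case: asboolP.
have wP' := upd0_proba e wP; set w0 := upd w e 0 in IH wP'.
pose X2 (D : {set T} -> {set T} -> Prop) := Ex w0 (fun E => Pr w0 (D E)).
pose D10 := fun F F' => D (e |: F) F'.
pose D01 := fun F F' => D F (e |: F').
pose D11 := fun F F' => D (e |: F) (e |: F').
pose DU := fun F F' => D10 F F' \/ D01 F F'.
have sub_e (E F : {set T}) : E \subset F -> e |: E \subset e |: F by apply: finset.setUS.
have I0 : Pr w0 (fun E => exists2 F : {set T}, F \subset E & D F (E :\: F)) <= X2 D.
  exact: IH.
have IU : Pr w0 (fun E => exists2 F : {set T}, F \subset E & DU F (E :\: F)) <= X2 DU.
  apply: IH => // E F F' FF' [] h; [left|right|left|right].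
  - exact: Dr FF' h.
  - exact: Dr (sub_e _ _ FF') h.
  - exact: Dl (sub_e _ _ FF') h.
  - exact: Dl FF' h.
have lhs : Pr w (fun E => exists2 F : {set T}, F \subset E & D F (E :\: F)) <=
  (1 - w e) * X2 D + w e * X2 DU.
  have /andP[we0 we1] := wP e.
  rewrite /Pr (Ex_cond _ e) -/w0; apply: lerD; apply: ler_wpM2l => //.
    by rewrite subr_ge0.
  apply: le_trans IU; apply: le_Pr => // E [F FE DF].
  have [eF|eF] := boolP (e \in F).
    exists (F :\ e); first by rewrite finset.subDset.
    left; rewrite /D10 finset.setD1K //; apply: Dr DF.
    apply/fintype.subsetP => x; rewrite !inE.
    by case/andP => xF /orP[/eqP xe|->]; [move: xF; rewrite xe eF|rewrite (negbTE xF) andbF].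
  exists F.
    apply/fintype.subsetP => x xF; move/fintype.subsetP: FE => /(_ x xF); rewrite !inE.
    by case/orP => // /eqP xe; move: eF; rewrite -xe xF.
  right; apply: Dr DF; apply/fintype.subsetP => x; rewrite !inE.
  by case/andP => -> /orP[]->; rewrite ?orbT.
apply: le_trans lhs _.
have -> : Ex w (fun E => Pr w (D E)) = (1 - w e) * ((1 - w e) * X2 D + w e * X2 D01)
   + w e * ((1 - w e) * X2 D10 + w e * X2 D11).
  rewrite (Ex_cond _ e) -/w0; congr (_ * _ + _ * _).
    rewrite -!ExZ -ExD; apply: eq_Ex => E; by rewrite [LHS](Ex_cond _ e).
  by rewrite -!ExZ -ExD; apply: eq_Ex => E; rewrite [LHS](Ex_cond _ e).
(* Inclusion and exclusion: [D] is contained in both [D10] and [D01], hence in their intersection.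
   In the final combination [H1] has weight [w e * (1 - w e)] and [H2] has weight [w e * w e]. *)
have H1 : X2 DU + X2 D <= X2 D10 + X2 D01.
  rewrite /X2 -!ExD; apply: le_Ex => // E; rewrite -[leRHS]PrU lerD2l; apply: le_Pr => // F DEF.
  by split; [apply: Dl DEF|apply: Dr DEF]; apply: finset.subsetUr.
have H2 : X2 DU <= X2 D11.
  apply: le_Ex => // E; apply: le_Pr => // F [] h; [apply: Dr h|apply: Dl h];
  exact: finset.subsetUr.
have /andP[] := wP e; move: (w e) => t h1 h2.
have := ler_wpM2l (mulr_ge0 h1 (_ : 0 <= 1 - t)) H1.
have := ler_wpM2l (mulr_ge0 h1 h1) H2.
by rewrite subr_ge0 => A1 /(_ h2); lra.
Qed.

Lemma BK w A B : proba w -> increasing A -> increasing B ->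
  Pr w (fun E => exists2 F : {set T}, F \subset E & A F /\ B (E :\: F)) <= Pr w A * Pr w B.
Proof.
move=> wP Am Bm; apply: le_trans (BK_rel (D := fun F F' => A F /\ B F') wP _ _) _.
- by move=> E F F' FF' [aE bF]; split=> //; apply: Bm bF.
- by move=> E F F' FF' [aE bF]; split=> //; apply: Am aE.
rewrite mulrC {1}/Pr -ExZ; apply: le_Ex => // E; rewrite mulrC {1}/Pr -ExZ; apply: le_Ex => // F.
by rewrite asbool_and -natrM mulnb andbC.
Qed.

(* The events of s occur on pairwise disjoint subsets of E. *)
Fixpoint docc (s : seq ({set T} -> Prop)) (E : {set T}) : Prop :=
  if s is A :: s' then exists2 F : {set T}, F \subset E & A F /\ docc s' (E :\: F)
  else True.

Lemma docc_increasing s : increasing (docc s).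
Proof.
elim: s => [|A s IHs] E E' EE' //= [F FE [AF sF]].
exists F; first exact: fintype.subset_trans EE'.
by split=> //; apply: IHs sF; apply: finset.setSD.
Qed.

Lemma docc_cat s1 s2 (E1 E2 : {set T}) : [disjoint E1 & E2] -> docc s1 E1 -> docc s2 E2 ->
  docc (s1 ++ s2) (E1 :|: E2).
Proof.
elim: s1 E1 => [|A s1 IH] E1 dis /=.
  by move=> _; apply: docc_increasing; apply: finset.subsetUr.
case=> F FE [AF sF] s2E; exists F.
  by apply: fintype.subset_trans FE _; apply: finset.subsetUl.
split=> //; have := IH (E1 :\: F) _ sF s2E.
move=> /(_ (disjointWl (finset.subsetDl _ _) dis)); apply: docc_increasing.
rewrite finset.setDUl; apply: finset.setUS; apply/fintype.subsetP => x x2.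
rewrite inE x2 andbT; apply/negP => /(fintype.subsetP FE) x1.
by move: dis => /pred0P /(_ x) /=; rewrite x1 x2.
Qed.

Lemma docc1 A E : A E -> docc [:: A] E.
Proof. by move=> AE; exists E. Qed.

Lemma BK_docc w s : proba w -> (forall A, List.In A s -> increasing A) ->
  Pr w (docc s) <= \prod_(A <- s) Pr w A.
Proof.
move=> wP; elim: s => [_|A s IHs sm]; first by rewrite big_nil Pr_le1.
rewrite big_cons /=; apply: le_trans (BK wP _ (@docc_increasing s)) _.
  by apply: sm; left.
by apply: ler_wpM2l; [apply: Pr_ge0 | apply: IHs => B Bs; apply: sm; right].
Qed.

(* P(Bin(m, p) >= s). *)
Fixpoint bin_tail (p : R) (m s : nat) : R :=
  match s, m with
  | 0, _ => 1
  | _.+1, 0 => 0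
  | s'.+1, m'.+1 => (1 - p) * bin_tail p m' s + p * bin_tail p m' s'
  end.

Lemma bin_tail_n0 p m : bin_tail p m 0 = 1. Proof. by case: m. Qed.

(** Conditioning on one element of [D] reproduces the recursion of [bin_tail]. The weights outside
    [D] are arbitrary, so the weight zeroed by the conditioning does no harm once its element has
    left [D]. *)
Lemma Pr_card_ge w p (D : {set T}) s : (forall e, e \in D -> w e = p) ->
  Pr w (fun E => (s <= #|E :&: D|)%N) = bin_tail p #|D| s.
Proof.
move: {2}#|D| (erefl #|D|) => m; elim: m w D s => [|m IHm] w D [|s] Dm wD;
  rewrite Dm; try by rewrite bin_tail_n0 Pr_True.
  rewrite /= -(Ex_cst w 0); apply: eq_Ex => E.
  by rewrite (cards0_eq Dm) finset.setI0 cards0; case: asboolP.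
rewrite /=.
have [e eD] : exists e, e \in D by apply/set0Pn; rewrite -card_gt0 Dm.
have Dm' : #|D :\ e| = m by move: Dm; rewrite (cardsD1 e) eD => -[].
have wD' x : x \in D :\ e -> upd w e 0 x = p.
  by rewrite !inE /upd => /andP[/negbTE -> /wD].
rewrite /Pr (Ex_cond _ e) wD //.
rewrite -{1}[in bin_tail p m s.+1]Dm' -[in bin_tail p m s]Dm' -!(IHm (upd w e 0)) //.
have h E : (e |: E) :&: D = e |: (E :&: (D :\ e)).
  apply/setP => x; rewrite !inE; case: (eqVneq x e) => [->|] //=; by rewrite eD.
congr (_ + _ * _); last first.
  apply: eq_Ex => E; rewrite h cardsU1 !inE eqxx /= andbF /= add1n.
  by rewrite ltnS.
rewrite [in LHS](Ex_split _ e) [in RHS]/Pr (Ex_split _ e) !mulr_sumr.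
apply: eq_bigr => E eE.
rewrite {2 4 6 8}/upd eqxx; congr (_ * (_ * (_ + _))); last by rewrite !mul0r.
congr (_ * (nat_of_bool (asbool (_ <= #|pred_of_set _|)%N))%:R).
by apply/setP => x; rewrite !inE; case: (eqVneq x e) => [->|//]; rewrite (negbTE eE).
Qed.

End BernoulliProduct.

(** * Poisson and binomial tails *)

Section PoissonTail.
Variable R : realType.
Implicit Types x y q c : R.

Lemma ger0_is_derive_le (f df : R -> R) (a b : R) :
  (forall x, is_derive x 1 f (df x)) -> a <= b ->
  (forall x, a <= x <= b -> 0 <= df x) -> f a <= f b.
Proof.
move=> fd ab df0.
have fder x : derivable f x 1 by apply: (@ex_derive _ _ _ _ _ _ _ (fd x)).
apply: (@ger0_derive1_le_cc R f a b) => //.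
- move=> x; rewrite in_itv /= => /andP[ax xb].
  by rewrite derive1E (@derive_val _ _ _ _ _ _ _ (fd x)) df0 // !ltW.
- apply: continuous_subspaceT => x.
  by apply: differentiable_continuous; apply/derivable1_diffP.
- by rewrite in_itv /= lexx ab.
- by rewrite in_itv /= lexx ab.
Qed.

Definition pois (k : nat) y : R := y ^+ k * k`!%:R^-1 * expR (- y).

(* P(Poisson(y) >= s). *)
Fixpoint phi (s : nat) y : R :=
  if s is s'.+1 then phi s' y - pois s' y else 1.

Lemma phiS s y : phi s.+1 y = phi s y - pois s y. Proof. by []. Qed.

Lemma pois_ge0 k y : 0 <= y -> 0 <= pois k y.
Proof. by move=> y0; rewrite /pois !mulr_ge0 ?exprn_ge0 ?expR_ge0 ?invr_ge0. Qed.

Lemma pois_gt0 k y : 0 < y -> 0 < pois k y.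
Proof. by move=> y0; rewrite /pois !mulr_gt0 ?exprn_gt0 ?expR_gt0 ?invr_gt0 ?ltr0n ?fact_gt0. Qed.

Lemma is_derive_expRN y : is_derive y 1 (fun x : R => expR (- x)) (- expR (- y)).
Proof.
by apply: is_derive_eq; rewrite mulrN1.
Qed.

Lemma is_derive_pois k y :
  is_derive y 1 (pois k.+1) (pois k y - pois k.+1 y).
Proof.
have d1 : is_derive y 1 (fun x : R => x ^+ k.+1) (k.+1%:R * y ^+ k).
  have -> : (fun x : R => x ^+ k.+1) = (id : R -> R) ^+ k.+1.
    by apply/funext => x; rewrite exprfctE.
  apply: is_derive_eq.
  by rewrite /GRing.scale /= mulr1.
have d2 := is_derive_expRN y.
rewrite /pois.
have -> : (fun y => y ^+ k.+1 / k.+1`!%:R * expR (- y)) =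
   cst (k.+1`!%:R^-1) * ((fun x : R => x ^+ k.+1) * (fun x : R => expR (- x))).
  apply/funext => x.
  change (x ^+ k.+1 / k.+1`!%:R * expR (- x) = k.+1`!%:R^-1 * (x ^+ k.+1 * expR (- x))).
  by rewrite [RHS]mulrA [_^-1 * _]mulrC.
apply: is_derive_eq; rewrite /GRing.scale /=.
have k0 : (k`!%:R : R) != 0 by rewrite pnatr_eq0 -lt0n fact_gt0.
have k1 : (k.+1%:R : R) != 0 by rewrite pnatr_eq0.
by rewrite factS natrM invfM exprS; field; rewrite k0 addrC natr1.
Qed.

(** The derivatives of the Poisson weights telescope and leave only the last one. *)
Lemma is_derive_phi s y : is_derive y 1 (phi s.+1) (pois s y).
Proof.
elim: s => [|s IHs].
  have -> : phi 1 = cst 1 - (fun x => expR (- x)).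
    by apply/funext => x /=; rewrite /pois expr0 fact0 invr1 !mul1r.
  have d := is_derive_expRN y.
  apply: is_derive_eq.
  by rewrite /pois expr0 fact0 invr1 !mul1r sub0r opprK.
have -> : phi s.+2 = phi s.+1 - pois s.+1 by apply/funext.
have d := is_derive_pois s y.
apply: is_derive_eq.
by rewrite subKr.
Qed.

Lemma phi_at0 s : phi s.+1 0 = 0.
Proof.
elim: s => [|s IHs]; rewrite phiS; first by rewrite /pois /= expr0 oppr0 expR0 fact0 invr1 !mul1r subrr.
by rewrite IHs /pois exprS !mul0r subr0.
Qed.

Lemma phi_homo s x y : 0 <= x -> x <= y -> phi s x <= phi s y.
Proof.
case: s => [|s] x0 xy //; apply: (ger0_is_derive_le (is_derive_phi s) xy).
by move=> z /andP[xz _]; rewrite pois_ge0 // (le_trans x0).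
Qed.

Lemma phi_ge0 s y : 0 <= y -> 0 <= phi s y.
Proof. by case: s => [|s] y0; [rewrite /= ler01|rewrite -(phi_at0 s) phi_homo]. Qed.

Lemma phiS_le s y : 0 <= y -> phi s.+1 y <= phi s y.
Proof. by move=> y0; rewrite phiS lerBlDr lerDl pois_ge0. Qed.

Lemma phi_le1 s y : 0 <= y -> phi s y <= 1.
Proof. by move=> y0; elim: s => //= s IHs; apply: le_trans IHs; rewrite -phiS phiS_le. Qed.

Lemma pois_le_phi s y : 0 <= y -> pois s y <= phi s y.
Proof. by move=> y0; rewrite -subr_ge0 -phiS phi_ge0. Qed.

Lemma phi_gt0 s y : 0 < y -> 0 < phi s y.
Proof. by move=> y0; apply: lt_le_trans (pois_le_phi _ (ltW y0)); apply: pois_gt0. Qed.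

Lemma phiS_le_phi1 s y : 0 <= y -> phi s.+1 y <= phi 1 y.
Proof. by move=> y0; elim: s => // s IHs; apply: le_trans (phiS_le _ y0) IHs. Qed.

Lemma phi1E y : phi 1 y = 1 - expR (- y).
Proof. by rewrite /= /pois expr0 fact0 invr1 !mul1r. Qed.

Lemma phiS_le_id s y : 0 <= y -> phi s.+1 y <= y.
Proof.
move=> y0; apply: le_trans (phiS_le_phi1 _ y0) _; rewrite phi1E.
by have := expR_ge1Dx (- y); lra.
Qed.

Lemma phiS_lt1 s y : 0 <= y -> phi s.+1 y < 1.
Proof.
move=> y0; apply: le_lt_trans (phiS_le_phi1 _ y0) _; rewrite phi1E.
by have := expR_gt0 (- y); lra.
Qed.

Lemma phiE s y : phi s y = 1 - \sum_(j < s) pois j y.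
Proof.
elim: s => [|s IHs]; first by rewrite big_ord0 subr0.
by rewrite phiS IHs big_ord_recr /= opprD addrA.
Qed.

(** The Poisson weight of [j] at mean [y] is [2 ^+ j * expR (- (y / 2))] times its weight at mean
    [y / 2], and the latter weights sum to at most 1. *)
Lemma phi_tail s y : 0 <= y -> 1 - phi s y <= 2 ^+ s * expR (- (y / 2)).
Proof.
move=> y0; rewrite phiE opprB addrC subrK.
have y20 : 0 <= y / 2 by rewrite divr_ge0.
have h : \sum_(j < s) pois j y <= 2 ^+ s * expR (- (y / 2)) * (1 - phi s (y / 2)).
  rewrite phiE opprB addrC subrK mulr_sumr; apply: ler_sum => j _.
  have -> : pois j y = 2 ^+ j * expR (- (y / 2)) * pois j (y / 2).
    have {1}-> : y = 2 * (y / 2) by field.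
    rewrite /pois exprMn.
    have -> : - (2 * (y / 2)) = - (y / 2) + - (y / 2) by ring.
    by rewrite expRD; ring.
  apply: ler_wpM2r; first exact: pois_ge0.
  apply: ler_wpM2r; first exact: expR_ge0.
  by apply: ler_weXn2l; [lra|apply: ltnW].
apply: le_trans h _; rewrite ger_pMr; last by rewrite mulr_gt0 ?exprn_gt0 ?expR_gt0.
by rewrite gerBl phi_ge0.
Qed.

(** The Poisson weight [pois k y] is at most 1. *)
Lemma exprn_le_expR k y : 0 <= y -> y ^+ k <= k`!%:R * expR y.
Proof.
move=> y0; have := le_trans (pois_le_phi k y0) (phi_le1 k y0).
by rewrite /pois expRN mulrAC ler_pdivrMr ?ltr0n ?fact_gt0 // mul1r ler_pdivrMr ?expR_gt0.
Qed.

(** [expR q] is an integrating factor: it merges [phi s.+1] and its derivative [pois s] into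
    [phi s]. When [c] is a value of [phi s], monotonicity then decides the sign. *)
Lemma is_derive_phi_aux s c y x :
  is_derive x 1 (fun q : R => expR q * phi s.+1 (y + q) - expR q * c)
    (expR x * (phi s (y + x) - c)).
Proof.
have d1 : is_derive x 1 (fun q : R => phi s.+1 (y + q)) (pois s (y + x)).
  apply: is_derive_eq.
    apply: (@is_derive1_comp _ (phi s.+1) (fun q => y + q) x (pois s (y + x)) 1).
      exact: is_derive_phi.
    have -> : (fun q => y + q) = cst y + id by [].
    by apply: is_derive_eq; rewrite add0r.
  by rewrite ?mulr1 ?mul1r.
have -> : (fun q : R => expR q * phi s.+1 (y + q) - expR q * c) =
   expR * (fun q : R => phi s.+1 (y + q)) - cst c * expR.
  by apply/funext => q; rewrite !addrfctE opprfctE !mulrfctE [_ * c]mulrC.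
apply: is_derive_eq; rewrite /GRing.scale /= -/(phi s.+1 _) phiS.
by ring.
Qed.

(** In probabilistic terms, Poisson(y) plus an independent Bernoulli variable of parameter
    [1 - expR (- q)] is dominated by Poisson(y + q). *)
Lemma phi_step_ge s y q : 0 <= y -> 0 <= q ->
  expR (- q) * phi s.+1 y + (1 - expR (- q)) * phi s y <= phi s.+1 (y + q).
Proof.
move=> y0 q0.
have := ger0_is_derive_le (is_derive_phi_aux s (phi s y) y) q0.
rewrite addr0 expR0 !mul1r => /(_ _) H.
have {H} : phi s.+1 y - phi s y <= expR q * phi s.+1 (y + q) - expR q * phi s y.
  apply: H => x /andP[x0 _]; rewrite mulr_ge0 ?expR_ge0 // subr_ge0.
  by rewrite phi_homo // lerDl.
rewrite -mulrBr => /(ler_wpM2l (expR_ge0 (- q))).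
rewrite mulrA [expR (- q) * expR q]mulrC expRxMexpNx_1 mul1r.
lra.
Qed.

(** The reverse comparison: if the additional Poisson(q) part is nonzero, its first point is set
    aside and what remains is dominated by Poisson(y + q). *)
Lemma phi_step_le s y q : 0 <= y -> 0 <= q ->
  phi s.+1 (y + q) <= expR (- q) * phi s.+1 y + (1 - expR (- q)) * phi s (y + q).
Proof.
move=> y0 q0.
have d x : is_derive x 1 (fun q' : R => expR q' * phi s (y + q) - expR q' * phi s.+1 (y + q'))
    (expR x * (phi s (y + q) - phi s (y + x))).
  have -> : (fun q' : R => expR q' * phi s (y + q) - expR q' * phi s.+1 (y + q')) =
     - (fun q' : R => expR q' * phi s.+1 (y + q') - expR q' * phi s (y + q)).
    by apply/funext => z /=; rewrite opprB.
  have d := is_derive_phi_aux s (phi s (y + q)) y x.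
  by apply: is_derive_eq; rewrite -mulrN opprB.
have := ger0_is_derive_le d q0.
rewrite addr0 expR0 !mul1r => /(_ _) H.
have {H} : phi s (y + q) - phi s.+1 y <= expR q * phi s (y + q) - expR q * phi s.+1 (y + q).
  apply: H => x /andP[x0 xq]; rewrite mulr_ge0 ?expR_ge0 // subr_ge0.
  by rewrite phi_homo ?addr_ge0 // lerD2l.
rewrite -mulrBr => /(ler_wpM2l (expR_ge0 (- q))).
rewrite mulrA [expR (- q) * expR q]mulrC expRxMexpNx_1 mul1r.
lra.
Qed.

Section BinomialTail.
Variables (p q : R).
Hypotheses (p0 : 0 <= p) (p1 : p < 1) (pq : expR (- q) = 1 - p).

Lemma rate_ge : p <= q.
Proof. by have := expR_ge1Dx (- q); rewrite pq; lra. Qed.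

Let q0 : 0 <= q. Proof. exact: le_trans rate_ge. Qed.

Lemma bin_tail_le_phi m s : bin_tail p m s <= phi s (q * m%:R).
Proof.
elim: m s => [|m IHm] [|s] //=; first by rewrite -[_ - _]/(phi s.+1 _) phi_ge0 ?mulr_ge0.
rewrite -[phi _ _ - _]/(phi s.+1 _).
have qm : 0 <= q * m%:R by rewrite mulr_ge0.
apply: le_trans (_ : _ <= expR (- q) * phi s.+1 (q * m%:R) + (1 - expR (- q)) * phi s (q * m%:R)) _.
  rewrite pq subKr; apply: lerD; apply: ler_wpM2l => //; rewrite subr_ge0 ltW //.
by apply: le_trans (phi_step_ge s qm q0) _; rewrite -natr1 mulrDr mulr1.
Qed.

(** The loss of [s] trials matches [phi_step_le], whose last term keeps the larger mean [y + q]: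
    lowering [s] by one gives one trial back. For [m <= s] and [s] positive the truncated
    subtraction makes the left side 0. *)
Lemma phi_le_bin_tail m s : phi s (q * (m - s)%:R) <= bin_tail p m s.
Proof.
elim: m s => [|m IHm] [|s] //; first by rewrite sub0n mulr0 phi_at0.
have [ms|sm] := leqP m s.
  have -> : (m.+1 - s.+1 = 0)%N by rewrite subSS; apply/eqP; rewrite subn_eq0.
  rewrite mulr0 phi_at0 /=.
  have bin_tail_ge0 k t : 0 <= bin_tail p k t.
    elim: k t => [|k IHk] [|t] //=; rewrite addr_ge0 ?mulr_ge0 ?subr_ge0 ?(ltW p1) //.
  by rewrite addr_ge0 // mulr_ge0 ?subr_ge0 // ltW.
rewrite subSS.
have [k mk] : exists k, (m - s = k.+1)%N by exists (m - s).-1; rewrite prednK // subn_gt0.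
have mk' : (m - s.+1 = k)%N by rewrite subnS mk.
have e : q * k.+1%:R = q * k%:R + q by rewrite -natr1 mulrDr mulr1.
have I1 := IHm s; have I2 := IHm s.+1.
rewrite mk' in I2; rewrite mk in I1 *; rewrite e in I1 *.
apply: le_trans (phi_step_le s _ q0) _; first by rewrite mulr_ge0.
by rewrite pq subKr; apply: lerD; apply: ler_wpM2l => //; rewrite subr_ge0 ltW.
Qed.

End BinomialTail.
End PoissonTail.

(** * Internally spanned intervals *)

Section Neighbors.
Variables (R : realType) (V : finType).
Implicit Types (E : {set {set V}}) (S : {set V}) (v w : V).

Definition star v S : {set {set V}} := [set [set v; w] | w in S :\ v].

Lemma set2_inj v : {in predC1 v &, injective (fun w => [set v; w])}.
Proof.
move=> w w'; rewrite !inE => wv w'v /setP /(_ w); rewrite !inE eqxx orbT (negbTE wv) /=.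
by move/esym/eqP.
Qed.

Lemma star_pairs v S : star v S \subset pairs V.
Proof.
apply/fintype.subsetP => e /imsetP[w]; rewrite !inE => /andP[wv _] ->.
by rewrite cards2; move: wv; rewrite eq_sym => ->.
Qed.

Lemma card_star v S : #|star v S| = #|S :\ v|.
Proof.
apply: card_in_imset => w w'; rewrite !inE => /andP[wv _] /andP[w'v _].
exact: set2_inj.
Qed.

(** Counting edges of a fixed set instead of vertices makes [Pr_card_ge] applicable. *)
Lemma nb_neighborsE E v S : nb_neighbors E v S = #|E :&: star v S|.
Proof.
rewrite /nb_neighbors -(card_in_imset (f := fun w => [set v; w])); last first.
  by move=> w w'; rewrite !inE => /and3P[_ wv _] /and3P[_ w'v _]; apply: set2_inj.
apply: eq_card => e; rewrite !inE; apply/imsetP/andP => [[w]|[eE /imsetP[w]]].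
  rewrite !inE => /and3P[wS wv wE] ->; split => //; apply/imsetP; exists w => //.
  by rewrite !inE wv wS.
by rewrite !inE => /andP[wv wS] ee; exists w; rewrite // !inE wv wS -ee.
Qed.

Lemma leq_nb_neighbors E E' v S S' : E \subset E' -> S \subset S' ->
  (nb_neighbors E v S <= nb_neighbors E' v S')%N.
Proof.
move=> /fintype.subsetP EE' /fintype.subsetP SS'; apply/subset_leq_card/fintype.subsetP => w.
by rewrite !inE => /and3P[/SS' -> -> /EE' ->].
Qed.

Lemma nb_neighbors_setI E (D : {set {set V}}) v S : star v S \subset D ->
  nb_neighbors (E :&: D) v S = nb_neighbors E v S.
Proof. by move=> vD; rewrite !nb_neighborsE -finset.setIA (finset.setIidPr vD). Qed.

(** The product measure lives on subsets of [{set V}]; weight 0 off [pairs V] confines it to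
    graphs. *)
Definition ew (p : R) (e : {set V}) : R := if e \in pairs V then p else 0.

Lemma ew_proba p : 0 <= p <= 1 -> proba (ew p).
Proof. by move=> p01 e; rewrite /ew; case: ifP => // _; rewrite lexx ler01. Qed.

Lemma Pr_nb_neighbors p v S s :
  Pr (ew p) (fun E => (s <= nb_neighbors E v S)%N) = bin_tail p #|S :\ v| s.
Proof.
rewrite -card_star -(@Pr_card_ge _ _ (ew p)).
  by apply: eq_Pr => E; rewrite nb_neighborsE.
by move=> e /(fintype.subsetP (star_pairs _ _)); rewrite /ew => ->.
Qed.

Lemma Pr_edge p e : e \in pairs V -> Pr (ew p) (fun E => e \in E) = p.
Proof.
move=> ep; transitivity (bin_tail p #|[set e]| 1).
  rewrite -(@Pr_card_ge _ _ (ew p)); last by move=> x /finset.set1P ->; rewrite /ew ep.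
  apply: eq_Pr => E; rewrite card_gt0; split => [eE|/set0Pn[x]].
    by apply/set0Pn; exists e; rewrite !inE eqxx eE.
  by rewrite !inE => /andP[xE /eqP <-].
by rewrite cards1 /= mulr0 mulr1 add0r.
Qed.

End Neighbors.

(** * Merging of adjacent intervals and the disjoint events that it forces *)

Section LineSpan.
Variables (V : finType) (sigma : nat) (c : nat -> V) (M : nat).
Hypothesis c_inj : {in gtn M &, injective c}.
Implicit Types (E : {set {set V}}) (x y z e : nat).

(* Intervals are half-open: vs x y is the set of c x, ..., c (y-1). *)
Definition vs x y : {set V} := [set v in [seq c i | i <- index_iota x y]].

Lemma vsP v x y : reflect (exists2 i, (x <= i < y)%N & v = c i) (v \in vs x y).
Proof.
rewrite inE; apply: (iffP mapP) => -[i]; rewrite ?mem_index_iota => ? ->; exists i => //.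
by rewrite mem_index_iota.
Qed.

Lemma mem_vs x y i : (x <= i < y)%N -> c i \in vs x y.
Proof. by move=> ixy; apply/vsP; exists i. Qed.

Lemma vsS x y x' y' : (x' <= x)%N -> (y <= y')%N -> vs x y \subset vs x' y'.
Proof. by move=> xx yy; apply/fintype.subsetP => v /vsP[i ? ->]; apply: mem_vs; lia. Qed.

Lemma vs_notin x y i : (y <= M)%N -> (i < M)%N -> c i \in vs x y -> (x <= i < y)%N.
Proof.
move=> yM iM /vsP[j jxy] cij; suff -> : i = j by [].
by apply: c_inj cij; rewrite inE //; lia.
Qed.

Lemma card_vs x y : (#|vs x y| <= y - x)%N.
Proof. by rewrite cardsE; apply: leq_trans (card_size _) _; rewrite size_map size_iota. Qed.

Lemma card_vs_eq x y : (y <= M)%N -> #|vs x y| = (y - x)%N.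
Proof.
move=> yM; rewrite cardsE; have /card_uniqP -> : uniq [seq c i | i <- index_iota x y].
  rewrite map_inj_in_uniq ?iota_uniq // => i j; rewrite !mem_index_iota => ? ?.
  by apply: c_inj; rewrite inE; lia.
by rewrite size_map size_iota.
Qed.

(** On a line the only puzzle edge between the two intervals crosses the gap at [y], so with
    [tau = 1] only its endpoints can satisfy (J1) or (J3). *)
Definition merge_cond E x y z : Prop :=
  [\/ [set c y.-1; c y] \in E, (sigma <= nb_neighbors E (c y.-1) (vs y z))%N |
      (sigma <= nb_neighbors E (c y) (vs x y))%N].

(* The interval [x, y) is internally spanned, by merging adjacent intervals two
   at a time. *)
Inductive sp E : nat -> nat -> Prop :=
| sp1 x : sp E x x.+1
| sp_merge x y z : sp E x y -> sp E y z -> merge_cond E x y z -> sp E x z.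

Lemma sp_lt E x y : sp E x y -> (x < y)%N.
Proof. by elim=> {x y} [x|x y z _ xy _ yz _] //; apply: ltn_trans yz. Qed.

Lemma merge_cond_incr x y z : increasing (fun E => merge_cond E x y z).
Proof.
move=> E E' EE' [h|h|h]; [apply: Or31|apply: Or32|apply: Or33].
- exact: (fintype.subsetP EE').
- by apply: leq_trans h _; apply: leq_nb_neighbors.
- by apply: leq_trans h _; apply: leq_nb_neighbors.
Qed.

Lemma sp_incr x y : increasing (fun E => sp E x y).
Proof.
move=> E E' EE'; elim=> {x y} [x|x y z _ xy _ yz g]; first exact: sp1.
by apply: sp_merge xy yz _; apply: merge_cond_incr g.
Qed.

Definition inner x y : {set {set V}} := [set e in pairs V | e \subset vs x y].

Lemma in_inner (e : {set V}) x y : (e \in inner x y) = (e \in pairs V) && (e \subset vs x y).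
Proof. by rewrite finset.in_set. Qed.

Definition cross x y z := inner x z :\: (inner x y :|: inner y z).

Lemma inner_sub x y x' y' : (x' <= x)%N -> (y <= y')%N -> inner x y \subset inner x' y'.
Proof.
move=> xx yy; apply/fintype.subsetP => e; rewrite !in_inner => /andP[-> /= h].
exact: fintype.subset_trans h (vsS xx yy).
Qed.

Lemma inner_disj x y z : (z <= M)%N -> (y <= z)%N -> [disjoint inner x y & inner y z].
Proof.
move=> zM yz; apply/pred0P => e /=; apply/negP => /andP[].
rewrite !in_inner => /andP[]; rewrite inE => /cards2P[v [w [vw ee]]] exy /andP[_ eyz].
have ve : v \in e by rewrite ee !inE eqxx.
have /vsP[i ixy vi] := fintype.subsetP exy _ ve.
have := fintype.subsetP eyz _ ve; rewrite vi => /vs_notin; lia.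
Qed.

Lemma crossE x y z i j : (x <= i < y)%N -> (y <= j < z)%N -> (z <= M)%N ->
  [set c i; c j] \in cross x y z.
Proof.
move=> ixy jyz zM; rewrite /cross finset.in_setD finset.in_setU !in_inner inE.
have cij : c i != c j.
  apply/eqP => /c_inj h; have ij : i = j by apply: h; rewrite inE; lia.
  by lia.
rewrite cards2 cij eqxx /=; apply/andP; split.
  rewrite negb_or; apply/andP; split; apply/fintype.subsetPn.
    exists (c j); first by rewrite !inE eqxx orbT.
    by apply/negP => /vs_notin; lia.
  exists (c i); first by rewrite !inE eqxx.
  by apply/negP => /vs_notin; lia.
by apply/fintype.subsetP => v; rewrite finset.in_set2 => /orP[] /eqP ->; apply: mem_vs; lia.
Qed.

Lemma star_cross_l x y z i : (x <= i < y)%N -> (z <= M)%N ->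
  star (c i) (vs y z) \subset cross x y z.
Proof.
move=> ixy zM; apply/fintype.subsetP => e /imsetP[w]; rewrite finset.in_setD1 => /andP[_ /vsP[j ? ->]] ->.
exact: crossE.
Qed.

Lemma star_cross_r x y z j : (y <= j < z)%N -> (z <= M)%N ->
  star (c j) (vs x y) \subset cross x y z.
Proof.
move=> jyz zM; apply/fintype.subsetP => e /imsetP[w]; rewrite finset.in_setD1 => /andP[_ /vsP[i ? ->]] ->.
by rewrite finset.setUC; apply: crossE.
Qed.

(** A merge inspects only pairs across [y]. These are disjoint from the pairs inside either half,
    which is the disjointness that the BK inequality exploits. *)
Lemma merge_cond_cross E x y z : (x < y < z)%N -> (z <= M)%N -> merge_cond E x y z ->
  merge_cond (E :&: cross x y z) x y z.
Proof.
move=> xyz zM [h|h|h]; [apply: Or31|apply: Or32|apply: Or33].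
- by rewrite inE h crossE //; lia.
- by rewrite nb_neighbors_setI // star_cross_l //; lia.
- by rewrite nb_neighbors_setI // star_cross_r //; lia.
Qed.

Lemma cross_sub x y z : cross x y z \subset inner x z.
Proof. exact: finset.subsetDl. Qed.

Lemma sp_inner E x y : (y <= M)%N -> sp E x y -> sp (E :&: inner x y) x y.
Proof.
move=> yM h; elim: h yM => {x y} [x|x y z xy IHx yz IHy g] zM; first exact: sp1.
have := sp_lt xy; have := sp_lt yz => ltyz ltxy.
apply: (@sp_merge _ x y z).
- apply: sp_incr (IHx _); last lia.
  by apply: finset.setIS; apply: inner_sub => //; lia.
- by apply: sp_incr (IHy zM); apply: finset.setIS; apply: inner_sub; lia.
- apply: merge_cond_incr (merge_cond_cross _ zM g); last lia.
  by apply: finset.setIS; apply: cross_sub.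
Qed.

Variable l : nat.

(* The growth past the gap (e-1, e) away from the core: [side] tells on which
   side of the gap the newly attached vertex lies. *)
Definition gev (side : bool) x y e E : Prop :=
  [\/ [set c e.-1; c e] \in E,
      (sigma <= nb_neighbors E (c (if side then e else e.-1)) (vs x y))%N |
      (sigma <= nb_neighbors E (c (if side then e.-1 else e)) (vs (e - l) (e + l)))%N].

Lemma gev_incr side x y e : increasing (gev side x y e).
Proof.
move=> E E' EE' [h|h|h]; [apply: Or31|apply: Or32|apply: Or33].
- exact: (fintype.subsetP EE').
- by apply: leq_trans h _; apply: leq_nb_neighbors.
- by apply: leq_trans h _; apply: leq_nb_neighbors.
Qed.

Lemma docc_cat3 (s1 s2 : seq ({set {set V}} -> Prop)) A E x y z :
  (x < y < z)%N -> (z <= M)%N ->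
  docc s1 (E :&: inner x y) -> A (E :&: cross x y z) -> docc s2 (E :&: inner y z) ->
  docc (s1 ++ A :: s2) (E :&: inner x z).
Proof.
move=> xyz zM h1 hA h2.
have dxy : [disjoint inner x y & inner y z] by apply: inner_disj; lia.
have dis (D1 D2 : {set {set V}}) : [disjoint D1 & D2] -> [disjoint E :&: D1 & E :&: D2].
  by move=> d; apply: disjointWl (finset.subsetIr _ _) (disjointWr (finset.subsetIr _ _) d).
have h := docc_cat (dis _ _ _) (docc1 hA) h2.
have {}h : docc (A :: s2) (E :&: (cross x y z :|: inner y z)).
  rewrite finset.setIUr; apply: h; apply/pred0P => e /=; rewrite /cross finset.in_setD finset.in_setU.
  by case: (e \in inner y z); rewrite ?orbT ?andbF.
have := docc_cat (dis _ _ _) h1 h; rewrite -finset.setIUr => /(_ _) hh.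
apply: docc_increasing (hh _).
  apply: finset.setIS; rewrite !finset.subUset cross_sub !inner_sub //; lia.
apply/pred0P => e /=; rewrite /cross finset.in_setU finset.in_setD finset.in_setU.
move/pred0P/(_ e): dxy => /=.
by case: (e \in inner x y); case: (e \in inner y z); rewrite ?orbT ?andbF.
Qed.

(** Since the piece on [side] is short, whatever neighbours the opposite vertex has in it lie within
    distance [l] of the gap: the third alternative of [gev]. The vertex of the short piece itself
    gives the second. *)
Lemma merge_cond_gev side x0 y0 E x y z : merge_cond E x y z -> (x0 <= x)%N -> (z <= y0)%N ->
  (x < y < z)%N -> (if side then z - y <= l else y - x <= l)%N -> gev side x0 y0 y E.
Proof.
move=> [h|h|h] x0x zy0 xyz sl; first exact: Or31.
- case: side sl => sl; [apply: Or33|apply: Or32]; apply: leq_trans h _;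
  by apply: leq_nb_neighbors => //; apply: vsS; lia.
- case: side sl => sl; [apply: Or32|apply: Or33]; apply: leq_trans h _;
  by apply: leq_nb_neighbors => //; apply: vsS; lia.
Qed.

Lemma index_iota_split x y z : (x <= y < z)%N ->
  index_iota x z = index_iota x y ++ y :: index_iota y.+1 z.
Proof.
move=> xyz; rewrite /index_iota (_ : z - x = (y - x) + (z - y.+1).+1)%N; last lia.
by rewrite iotaD /= (_ : x + (y - x) = y)%N; last lia.
Qed.

(** Below length [l] both pieces of every merge are short, so each gap can be charged on whichever
    side is prescribed. *)
Lemma gap_docc side x0 y0 E x y : sp E x y -> (x0 <= x)%N -> (y <= y0)%N -> (y <= M)%N ->
  (y - x <= l)%N ->
  docc [seq gev side x0 y0 e | e <- index_iota x.+1 y] (E :&: inner x y).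
Proof.
elim=> {x y} [x|x y z xy IHx yz IHy g] x0x yy0 yM yxl.
  by rewrite /index_iota subnn.
have := sp_lt xy; have := sp_lt yz => ltyz ltxy.
rewrite (@index_iota_split _ y) ?map_cat; last lia.
have xyz : (x < y < z)%N by lia.
rewrite map_cons; apply: (docc_cat3 xyz yM).
- by apply: IHx; lia.
- apply: merge_cond_gev (merge_cond_cross _ yM g) _ _ _ _ => //; try lia.
  by case: ifP => _; lia.
- by apply: IHy; lia.
Qed.

Definition growth_events x0 y0 x y a b d : seq ({set {set V}} -> Prop) :=
  [seq gev false x0 y0 e | e <- index_iota x.+1 a.+1] ++
  [:: (fun E => sp E a b), (fun E => sp E b d) &
      [seq gev true x0 y0 e | e <- index_iota d y]].

(** Beside a child longer than [t] there is room for at most [y0 - x0 - t <= l] vertices, so the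
    sibling is short and all its gaps yield [gev]. Neighbours are counted in the fixed outer
    interval [[x0, y0)], so the event lists of successive levels concatenate. *)
Lemma sp_descend x0 y0 t E x y : (y0 - x0 - t <= l)%N -> (0 < t)%N ->
  sp E x y -> (x0 <= x)%N -> (y <= y0)%N -> (y <= M)%N -> (t < y - x)%N ->
  exists a b d, [/\ (x <= a < b)%N, (b < d <= y)%N, (b - a <= t)%N, (d - b <= t < d - a)%N &
    docc (growth_events x0 y0 x y a b d) (E :&: inner x y)].
Proof.
move=> tl t0; elim=> {x y} [x|x y z xy IHx yz IHy g] x0x yy0 yM tyx; first by lia.
have := sp_lt xy; have := sp_lt yz => ltyz ltxy.
have xyz : (x < y < z)%N by lia.
have [yx|yx] := leqP (y - x) t; last first.
  have [|||| a [b [d [h1 h2 h3 h4 h5]]]] := IHx; try lia.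
  exists a, b, d; split => //; try lia.
  rewrite /growth_events (@index_iota_split d y) ?map_cat; last lia.
  rewrite map_cons -2!cat_cons catA; apply: (docc_cat3 xyz yM h5).
    by apply: merge_cond_gev (merge_cond_cross _ yM g) _ _ _ _ => //; lia.
  by apply: gap_docc => //; lia.
have [zy|zy] := leqP (z - y) t; last first.
  have [|||| a [b [d [h1 h2 h3 h4 h5]]]] := IHy; try lia.
  exists a, b, d; split => //; try lia.
  rewrite /growth_events (@index_iota_split x.+1 y a.+1) ?map_cat; last lia.
  rewrite map_cons -catA cat_cons; apply: (docc_cat3 xyz yM _ _ h5).
    by apply: gap_docc => //; lia.
  by apply: merge_cond_gev (merge_cond_cross _ yM g) _ _ _ _ => //; lia.
exists x, y, z; split => //; try lia.
rewrite /growth_events /index_iota !subnn /=.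
have hx : sp (E :&: inner x y) x y by apply: sp_inner => //; lia.
have hy := sp_inner yM yz.
(* The merge of the two final children is charged nothing, hence the trivial event; only the
   disjointness of their inner pairs is kept. *)
have := docc_cat3 (s1 := [:: fun E => sp E x y]) (s2 := [:: fun E => sp E y z])
  (A := fun=> True) xyz yM (docc1 hx) I (docc1 hy).
case=> F FE [spF [F' F'E [_ [F'' F''E [spF'' _]]]]].
exists F => //; split => //; exists F''; last by split.
by apply: fintype.subset_trans F''E _; apply: finset.subsetDl.
Qed.

End LineSpan.

(** * Probability that an interval is internally spanned *)

Section SpanBound.
Variables (R : realType) (V : finType) (sigma : nat) (c : nat -> V) (M l : nat).
Hypothesis c_inj : {in gtn M &, injective c}.
Variables (p q : R) (s : nat -> R) (alpha : R).
Hypotheses (p0 : 0 <= p) (p1 : p < 1) (pq : expR (- q) = 1 - p).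

Let q0 : 0 <= q. Proof. exact: le_trans p0 (rate_ge pq). Qed.
Let wP : proba (@ew R V p). Proof. by apply: ew_proba; rewrite p0 ltW. Qed.

(** One term per alternative of [gev]: the middle one is the main term, the outer ones the
    corrections for double edges and for short-range neighbours. *)
Definition gap_cost m : R := p + phi sigma (q * m%:R) + phi sigma (q * (2 * l)%:R).

Lemma gap_cost_ge0 m : 0 <= gap_cost m.
Proof. by rewrite /gap_cost !addr_ge0 ?phi_ge0 ?mulr_ge0. Qed.

Lemma Pr_nb_le v (S : {set V}) m : (#|S| <= m)%N ->
  Pr (ew p) (fun E => (sigma <= nb_neighbors E v S)%N) <= phi sigma (q * m%:R).
Proof.
move=> Sm; rewrite Pr_nb_neighbors; apply: le_trans (bin_tail_le_phi _ _ pq _ _) _ => //.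
apply: phi_homo; first by rewrite mulr_ge0.
apply: ler_wpM2l => //; rewrite ler_nat; apply: leq_trans Sm.
by apply/subset_leq_card/finset.subsetDl.
Qed.

Lemma Pr_gev side x y e : (x < e < y)%N -> (y <= M)%N ->
  Pr (ew p) (gev sigma c l side x y e) <= gap_cost (y - x).
Proof.
move=> xey yM.
have h1 : Pr (ew p) (fun E => [set c e.-1; c e] \in E) = p.
  apply: Pr_edge; rewrite inE cards2;
  have -> // : c e.-1 != c e.
  apply/eqP => /c_inj h; have : e.-1 = e by apply: h; rewrite inE; lia.
  by lia.
have h2 := @Pr_nb_le (c (if side then e else e.-1)) _ _ (card_vs c x y).
have h3 := @Pr_nb_le (c (if side then e.-1 else e)) (vs c (e - l) (e + l)) (2 * l)%N.
have {}h3 := h3 ltac:(apply: leq_trans (card_vs c _ _) _; lia).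
apply: le_trans (lerD (lerD (lexx _) h2) h3); rewrite -{2}h1.
apply: le_trans (lerD (PrU_le _ _ wP) (lexx _)); apply: le_trans (PrU_le _ _ wP).
by apply: le_Pr => // E [h|h|h]; [left; left|left; right|right].
Qed.

Lemma prod_gev_le side x y (r : seq nat) : {in r, forall e, (x < e < y)%N} -> (y <= M)%N ->
  \prod_(A <- [seq gev sigma c l side x y e | e <- r]) Pr (ew p) A <=
  gap_cost (y - x) ^+ size r.
Proof.
move=> + yM; rewrite big_map; elim: r => [|e r IHr] rP; first by rewrite big_nil.
rewrite big_cons exprS; apply: ler_pM; rewrite ?Pr_ge0 ?prodr_ge0 //.
- by move=> *; apply: Pr_ge0.
- by apply: Pr_gev => //; apply: rP; rewrite inE eqxx.
- by apply: IHr => i ir; apply: rP; rewrite inE ir orbT.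
Qed.

(** [s u] is the exponent charged for growing past length [u]. A gap crossed inside an interval of
    length [m] may be charged at any of the top [l] lengths below [m], whence [m <= u + l]. [alpha]
    pays for a union bound over three endpoints in [[0, M]]. *)
Hypothesis s_noninc : forall u v, (u <= v)%N -> s v <= s u.
Hypothesis gap_cost_le : forall m u, (u < m)%N -> (m <= u + l)%N -> (m <= M)%N ->
  gap_cost m <= expR (- s u).
Hypotheses (alphaM : M.+1%:R ^+ 3 <= expR alpha) (alpha_s : s 0%N <= alpha).
Hypothesis l0 : (0 < l)%N.

Let alpha0 : 0 <= alpha.
Proof.
by rewrite -ler_expR expR0; apply: le_trans alphaM; rewrite exprn_ege1 // ler1n.
Qed.

Definition slope_sum m : R := \sum_(0 <= u < m) s u.
(* Bounds the number of union bounds paid in the merging tree of an interval of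
   length m, by node_count_split. *)
Definition node_count m : R := Num.max 1 (4 * m%:R / l%:R - 1).

Lemma slope_sum_cat m n : (n <= m)%N ->
  slope_sum m = slope_sum n + \sum_(n <= u < m) s u.
Proof. by move=> nm; rewrite /slope_sum (@big_cat_nat _ _ _ n). Qed.

Lemma slope_sum_subadd a b : slope_sum (a + b) <= slope_sum a + slope_sum b.
Proof.
rewrite (slope_sum_cat (leq_addr b a)) lerD2l -{1}[a]add0n big_addn addKn.
by apply: ler_sum => i _; apply: s_noninc; apply: leq_addr.
Qed.

(** If both children exceed [l / 2], the constants [-1] absorb the new node and [a + b <= m]
    suffices. If one is smaller and counts 1, the other has at most [m - l] vertices, which frees 4.
    If both are smaller, [l < m] gives 3 on the right. *)
Lemma node_count_split a b m : (a <= m - l)%N -> (b <= m - l)%N -> (a + b <= m)%N ->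
  (l < m)%N -> 1 + node_count a + node_count b <= node_count m.
Proof.
move=> am bm abm lm; have lR : 0 < (l%:R : R) by rewrite ltr0n.
have h k : (k <= m - l)%N -> k%:R / l%:R <= m%:R / l%:R - 1 :> R.
  move=> km; rewrite ler_pdivrMr // mulrBl mul1r divfK ?gt_eqF // lerBrDr -natrD ler_nat; lia.
have hab : a%:R / l%:R + b%:R / l%:R <= m%:R / l%:R :> R.
  by rewrite -mulrDl -natrD ler_wpM2r ?invr_ge0 // ler_nat.
have hm : 1 <= m%:R / l%:R :> R by rewrite ler_pdivlMr // mul1r ler_nat ltnW.
have ha := h _ am; have hb := h _ bm; rewrite /node_count -!mulrA.
move: (a%:R / _) (b%:R / _) (m%:R / _) ha hb hab hm => A B C ha hb hab hm.
rewrite /Order.max; case: ltP => h1; case: ltP => h2; case: ltP => h3; lra.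
Qed.

Lemma gap_cost_exp m k : (k <= l)%N -> (k <= m)%N -> (m <= M)%N ->
  gap_cost m ^+ k <= expR (- \sum_(m - k <= u < m) s u).
Proof.
move=> kl km mM; rewrite -sumrN expR_sum.
have -> : gap_cost m ^+ k = \prod_(m - k <= u < m) gap_cost m.
  by rewrite prodr_const_nat; congr (_ ^+ _); lia.
rewrite !big_nat; apply: ler_prod => u umk; rewrite gap_cost_ge0 /=.
by apply: gap_cost_le => //; lia.
Qed.

(** The gaps outside [[a, d)] supply the slopes from [d - a] to [y - x]; subadditivity of
    [slope_sum] lets the two children supply those below [d - a]. One [alpha] is left over for the
    choice of [(a, b, d)]. *)
Lemma Pr_growth_events_le x y a b d : (y <= M)%N -> (l < y - x)%N ->
  (x <= a < b)%N -> (b < d <= y)%N -> (b - a <= y - x - l)%N ->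
  (d - b <= y - x - l < d - a)%N ->
  Pr (ew p) (fun E => sp sigma c E a b) <= expR (alpha * node_count (b - a) - slope_sum (b - a)) ->
  Pr (ew p) (fun E => sp sigma c E b d) <= expR (alpha * node_count (d - b) - slope_sum (d - b)) ->
  Pr (ew p) (docc (growth_events sigma c l x y x y a b d)) <=
  expR (alpha * (node_count (y - x) - 1) - slope_sum (y - x)).
Proof.
move=> yM lyx h1 h2 h3 h4 I1 I2.
have e1 : (a.+1 - x.+1 + (y - d) = (y - x) - (d - a))%N by lia.
have e2 : ((y - x) - (d - a) <= l)%N by lia.
have e3 : ((y - x) - (d - a) <= y - x)%N by lia.
have e4 : ((y - x) - ((y - x) - (d - a)) = d - a)%N by lia.
have e5 : (b - a + (d - b) = d - a)%N by lia.
have e6 : (d - a <= y - x)%N by lia.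
have e7 : (y - x <= M)%N by lia.
have r1 : {in index_iota x.+1 a.+1, forall e, (x < e < y)%N}.
  by move=> e; rewrite mem_index_iota; lia.
have r2 : {in index_iota d y, forall e, (x < e < y)%N}.
  by move=> e; rewrite mem_index_iota; lia.
apply: le_trans (BK_docc wP _) _.
  move=> A /List.in_app_iff[/List.in_map_iff[e [<- _]]|]; first exact: gev_incr.
  move=> /= [<-|[<-|/List.in_map_iff[e [<- _]]]]; [exact: sp_incr|exact: sp_incr|exact: gev_incr].
rewrite big_cat /= !big_cons.
have G1 := @prod_gev_le false x y _ r1 yM.
have G2 := @prod_gev_le true x y _ r2 yM.
have PP (A : seq _) : 0 <= \prod_(B <- A) Pr (@ew R V p) B.
  by apply: prodr_ge0 => *; apply: Pr_ge0.
have G := le_trans (ler_pM (PP _) (PP _) G1 G2) _.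
rewrite -exprD !size_iota e1 in G.
have {}G := G _ (gap_cost_exp e2 e3 e7); rewrite e4 in G.
have I := ler_pM (Pr_ge0 _ wP) (Pr_ge0 _ wP) I1 I2; rewrite -expRD in I.
have := ler_pM (mulr_ge0 (PP _) (PP _)) (mulr_ge0 (Pr_ge0 _ wP) (Pr_ge0 _ wP)) G I.
rewrite -expRD.
set A1 := \prod_(_ <- _) _; set A2 := \prod_(_ <- _) _.
have -> (B1 B2 : R) : A1 * (B1 * (B2 * A2)) = A1 * A2 * (B1 * B2) by ring.
move=> /le_trans; apply; rewrite ler_expR.
have := slope_sum_subadd (b - a) (d - b); rewrite e5.
rewrite [slope_sum (y - x)](slope_sum_cat e6).
have := ler_wpM2l alpha0 (@node_count_split (b - a) (d - b) (y - x) h3 _ _ lyx).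
have -> : (d - b <= y - x - l)%N by case/andP: h4.
rewrite e5 e6 => /(_ isT isT).
by lra.
Qed.

Lemma Pr_sp_le x y : (x < y)%N -> (y <= M)%N ->
  Pr (ew p) (fun E => sp sigma c E x y) <=
  expR (alpha * node_count (y - x) - slope_sum (y - x)).
Proof.
have [k] := ubnP (y - x)%N; elim: k x y => [|k IHk] x y yxk xy yM.
  by lia.
set m := (y - x)%N; have mM : (m <= M)%N by rewrite /m; lia.
(* A short interval of [m] vertices has only [m - 1] gaps; the missing slope [s 0] is covered by
   [alpha]. *)
have [ml|lm] := leqP m l.
  apply: (@le_trans _ _ (gap_cost m ^+ m.-1)).
    have -> : m.-1 = size (index_iota x.+1 y) by rewrite size_iota /m; lia.
    apply: le_trans (prod_gev_le true _ yM); last by move=> e; rewrite mem_index_iota.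
    apply: le_trans (BK_docc wP _); last first.
      by move=> A /List.in_map_iff[e [<- _]]; apply: gev_incr.
    apply: le_Pr => // E spE.
    apply: docc_increasing (gap_docc c_inj true spE (leqnn _) (leqnn _) yM ml).
    exact: finset.subsetIl.
  apply: le_trans (gap_cost_exp _ _ mM) _; [lia|lia|rewrite ler_expR].
  have -> : (m - m.-1 = 1)%N by rewrite /m; lia.
  have -> : slope_sum m = s 0%N + \sum_(1 <= u < m) s u.
    by rewrite /slope_sum big_ltn // /m; lia.
  have : alpha <= alpha * node_count m by rewrite ler_peMr // /node_count le_max lexx.
  by move: alpha_s; lra.
set t := (m - l)%N.
(* All triples of endpoints are listed, at most [expR alpha] of them by [alphaM]; the shape
   condition [P] is made part of the event. *)
pose I := ('I_M.+1 * 'I_M.+1 * 'I_M.+1)%type.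
pose P (i : I) := let: (a, b, d) := i in
  [&& (x <= a < b)%N, (b < d <= y)%N, (b - a <= t)%N & (d - b <= t < d - a)%N].
pose D (i : I) E := P i /\ let: (a, b, d) := i in
  docc (growth_events sigma c l x y x y a b d) E.
have step : Pr (ew p) (fun E => sp sigma c E x y) <= \sum_(i <- enum {: I}) Pr (ew p) (D i).
  apply: le_trans (Pr_exists_le _ _ wP); apply: le_Pr => // E spE.
  have [|||a [b [d [h1 h2 h3 h4 h5]]]] :=
    sp_descend (l := l) (x0 := x) (y0 := y) (t := t) c_inj _ _ spE (leqnn _) (leqnn _) yM.
  - by rewrite /t /m; lia.
  - by rewrite /t; lia.
  - by rewrite /t /m; lia.
  have [aM [bM dM]] : (a < M.+1 /\ b < M.+1 /\ d < M.+1)%N by lia.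
  exists (Ordinal aM, Ordinal bM, Ordinal dM); first by rewrite mem_enum.
  rewrite /D /P /= h1 h2 h3 h4; split=> //.
  by apply: docc_increasing h5; apply: finset.subsetIl.
apply: le_trans step _.
have bound i : Pr (ew p) (D i) <= expR (alpha * (node_count m - 1) - slope_sum m).
  case: (boolP (P i)) => [Pi|nPi]; last first.
    apply: le_trans (expR_ge0 _); rewrite -[leRHS](Ex_cst (@ew R V p)); apply: le_Ex => // E.
    by case: asboolP => // -[]; rewrite (negbTE nPi).
  case: i Pi => -[[a aM] [b bM]] [d dM] /and4P[/= h1 h2 h3 h4].
  apply: (@le_trans _ _ (Pr (ew p) (docc (growth_events sigma c l x y x y a b d)))).
    by apply: le_Pr => // E [].
  have [k1 k2 k3 k4] : [/\ b - a < k, d - b < k, b <= M & d <= M]%N.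
    by clear -yxk h1 h2 h3 h4 lm yM l0; rewrite /t /m in lm h3 h4 *; split; lia.
  apply: Pr_growth_events_le => //; apply: IHk => //; [by case/andP: h1|by case/andP: h2].
apply: le_trans (ler_sum _ (fun i _ => bound i)) _.
rewrite big_const_seq count_predT -cardE !card_prod !card_ord iter_addr_0.
rewrite -[_ *+ _]mulr_natl (_ : (M.+1 * M.+1 * M.+1)%:R = M.+1%:R ^+ 3); last first.
  by rewrite !natrM -mulrA -expr2 -exprS.
have -> : alpha * node_count m - slope_sum m = alpha + (alpha * (node_count m - 1) - slope_sum m).
  by ring.
by rewrite expRD ler_wpM2r ?expR_ge0.
Qed.

End SpanBound.

(** * The jigsaw dynamics *)

Section Dynamics.
Variables (V : finType) (Epuz : {set {set V}}) (sigma : nat) (E : {set {set V}}).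
Implicit Types (A B W : {set V}) (P : {set {set V}}).

Notation adj P := (piece_adj Epuz sigma 1 None E P).
Notation step := (jigsaw_step Epuz sigma 1 None E).

(** Adjacency for [tau = 1] and infinite [theta], in a symmetric form that makes sense for arbitrary
    sets and not only for members of a partition. *)
Definition touch A B : Prop := exists v w, [/\ v \in A, w \in B, [set v; w] \in Epuz &
  [\/ [set v; w] \in E, (sigma <= nb_neighbors E v B)%N | (sigma <= nb_neighbors E w A)%N]].

(* Merging pieces two at a time, not whole components at once, makes sizes at
   most double, so that an internally spanned set exists at every scale. *)
Inductive ispan : {set V} -> Prop :=
| ispan1 v : ispan [set v]
| ispanU A B : ispan A -> ispan B -> [disjoint A & B] -> touch A B -> ispan (A :|: B).

Lemma touch_sym A B : touch A B -> touch B A.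
Proof.
case=> v [w [vA wB vw h]]; exists w, v; rewrite finset.setUC; split=> //.
by case: h => h; [apply: Or31|apply: Or33|apply: Or32].
Qed.

Lemma touch_sub A B A' B' : A \subset A' -> B \subset B' -> touch A B -> touch A' B'.
Proof.
move=> AA' BB' [v [w [vA wB vw h]]]; exists v, w; split=> //.
- exact: (fintype.subsetP AA').
- exact: (fintype.subsetP BB').
case: h => h; [apply: Or31|apply: Or32|apply: Or33] => //;
by apply: leq_trans h _; apply: leq_nb_neighbors.
Qed.

Lemma J_touch A B : J1 Epuz E A B || J3 Epuz sigma 1 E A B -> touch A B.
Proof.
case/orP => [/exists_inP[v vA /exists_inP[w wB]]|/exists_inP[v vA /andP[h]]].
  by rewrite inE => /andP[vwE vw]; exists v, w; split=> //; apply: Or31.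
rewrite /link /nb_neighbors card_gt0 => /set0Pn[w]; rewrite inE => /and3P[wB wv vw].
by exists v, w; split=> //; apply: Or32.
Qed.

Lemma adj_touch P A B : adj P A B -> touch A B.
Proof.
case/and4P=> _ _ _; rewrite /J2 /= => /or4P[h|h|h|h].
- by apply: J_touch; rewrite h.
- by apply: J_touch; rewrite h orbT.
- by apply: touch_sym; apply: J_touch; rewrite h.
- by apply: touch_sym; apply: J_touch; rewrite h orbT.
Qed.

Lemma adj_sym P : symmetric (adj P).
Proof.
move=> A B; rewrite /piece_adj [B == A]eq_sym; case: (A \in P) (B \in P) => [] [] //=.
case: (A == B) => //=.
by case: (J1 _ _ A B) (J1 _ _ B A) (J3 _ _ _ _ A B) (J3 _ _ _ _ B A) => [] [] [] [].
Qed.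

Let comp P A := [set W in P | connect (adj P) A W].

Lemma comp_eq P A B : connect (adj P) A B -> comp P A = comp P B.
Proof.
move=> AB; apply/setP => W; rewrite !inE; case: (W \in P) => //=.
by apply: same_connect => //; apply/sym_connect_sym/adj_sym.
Qed.

Lemma partition_step P : finset.partition P [set: V] -> finset.partition (step P) [set: V].
Proof.
case/and3P=> /eqP cP /finset.trivIsetP tP nP; apply/and3P; split.
- apply/eqP/setP => x; rewrite !inE; have : x \in finset.cover P by rewrite cP inE.
  case/bigcupP => W WP xW; apply/bigcupP; exists (finset.cover (comp P W)).
    by apply/imsetP; exists W.
  by apply/bigcupP; exists W => //; rewrite inE WP connect0.
- apply/finset.trivIsetP => _ _ /imsetP[A AP ->] /imsetP[B BP ->]; apply: contraR.
  case/pred0Pn => x /andP[/bigcupP[A' A'C xA'] /bigcupP[B' B'C xB']].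
  move: A'C B'C; rewrite !inE => /andP[A'P AA'] /andP[B'P BB'].
  have AB' : A' = B'.
    apply/eqP; apply: contraT => /(tP _ _ A'P B'P) /pred0P/(_ x) /=.
    by rewrite xA' xB'.
  apply/eqP; congr (finset.cover _); rewrite -/(comp P A) -/(comp P B).
  by rewrite (comp_eq AA') AB' (comp_eq BB').
- apply/imsetP => -[A AP] /esym/eqP; apply/negP; apply/set0Pn.
  have /set0Pn[x xA] : A != finset.set0 by apply: contraNneq nP => <-.
  by exists x; apply/bigcupP; exists A => //; rewrite inE AP connect0.
Qed.

Lemma partition_singletons : finset.partition (Defs.singletons V) [set: V].
Proof.
apply/and3P; split.
- apply/eqP/setP => x; rewrite !inE; apply/bigcupP; exists [set x]; rewrite ?inE //.
  by apply/imsetP; exists x.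
- apply/finset.trivIsetP => _ _ /imsetP[x _ ->] /imsetP[y _ ->] xy.
  by rewrite disjoints1 inE; apply: contraNneq xy => ->.
- by apply/imsetP => -[x _] /setP/(_ x); rewrite !inE eqxx.
Qed.

Section AizenmanLebowitz.
Variable k : nat.
Hypothesis nospan : forall S, ispan S -> (k <= #|S| < 2 * k)%N -> False.

Let small P := finset.partition P [set: V] /\
  forall W, W \in P -> ispan W /\ (#|W| < k)%N.

(** Inside the component of [W], take a largest family containing [W] whose union is spanned and
    smaller than [k]. Adding an adjacent piece gives a spanned union of size below [2 * k], hence
    below [k] by [nospan], against maximality. So the family is closed under adjacency and is the
    whole component. *)
Lemma small_step P : small P -> small (step P).
Proof.
case=> pP sP; split; first exact: partition_step.
have /and3P[_ /finset.trivIsetP tP _] := pP.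
move=> _ /imsetP[W WP ->]; rewrite -/(comp P W).
pose good (C : {set {set V}}) :=
  [&& C \subset comp P W, W \in C & `[< ispan (finset.cover C) /\ (#|finset.cover C| < k)%N >]].
have gW : good [set W].
  rewrite /good finset.sub1set !inE WP connect0 eqxx /=; apply/asboolP.
  by rewrite /finset.cover finset.big_set1; apply: sP.
pose C := [arg max_(C > [set W] | good C) #|C|].
have [gC Cmax] : good C /\ forall C', good C' -> (#|C'| <= #|C|)%N.
  by rewrite /C; case: arg_maxnP => // C' gC' mC'; split.
case/and3P: gC => CC WC /asboolP[sC szC].
have CP : C \subset P.
  by apply: fintype.subset_trans CC _; apply/fintype.subsetP => B; rewrite inE => /andP[].
suff -> : comp P W = C by [].
have closedC A B : A \in C -> adj P A B -> B \in C.
  move=> AC AB; apply: contraT => BC.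
  have BP : B \in P by case/and4P: AB.
  have [sB szB] := sP _ BP.
  have cU : finset.cover (B |: C) = finset.cover C :|: B.
    by rewrite /finset.cover big_setU1 //= finset.setUC.
  have dis : [disjoint finset.cover C & B].
    apply/pred0P => x /=; apply/negP => /andP[/bigcupP[D DC xD] xB].
    have := tP _ _ (fintype.subsetP CP _ DC) BP.
    have -> : D != B by apply: contraNneq BC => <-.
    by move=> /(_ isT) /pred0P/(_ x) /=; rewrite xD xB.
  have sU : ispan (finset.cover (B |: C)).
    rewrite cU; apply: ispanU => //; apply: touch_sub (adj_touch AB) => //.
    exact: finset.bigcup_sup.
  have szU : (#|finset.cover (B |: C)| < 2 * k)%N.
    rewrite cU; apply: leq_ltn_trans (leq_card_setU _ _) _.
    by rewrite mul2n -addnn -addSn; apply: leq_add => //; apply: ltnW.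
  have gU : good (B |: C).
    have AW := fintype.subsetP CC _ AC; rewrite inE in AW; case/andP: AW => _ AW.
    rewrite /good finset.subUset finset.sub1set CC !inE BP (connect_trans AW (connect1 AB)) WC orbT /=.
    apply/asboolP; split=> //.
    by rewrite ltnNge; apply/negP => h; apply: (nospan sU); rewrite h.
  by have := Cmax _ gU; rewrite cardsU1 BC ltnn.
apply/eqP; rewrite finset.eqEsubset CC andbT; apply/fintype.subsetP => B.
rewrite inE => /andP[_ WB].
have cl : fingraph.closed (adj P) (mem C).
  move=> A A' AA'; apply/idP/idP => [h|h]; first exact: closedC AA'.
  by apply: closedC h _; rewrite adj_sym.
by have := closed_connect cl WB; rewrite /= WC => <-.
Qed.

Lemma solve_small : (2 <= k)%N -> solve Epuz sigma 1 None E -> (#|V| < k)%N.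
Proof.
move=> k2 [t tP].
have : small (iter t step (Defs.singletons V)).
  elim: t {tP} => [|t IHt]; last by rewrite iterS; apply: small_step.
  split; first exact: partition_singletons.
  by move=> _ /imsetP[v _ ->]; split; [exact: ispan1|rewrite cards1].
by rewrite tP => -[_ /(_ [set: V])]; rewrite inE eqxx cardsT => /(_ isT)[].
Qed.

End AizenmanLebowitz.

Lemma solve_ispan k : (2 <= k <= #|V|)%N -> solve Epuz sigma 1 None E ->
  exists2 S, ispan S & (k <= #|S| < 2 * k)%N.
Proof.
case/andP=> k2 kV sol; apply: contrapT => nS.
suff : (#|V| < k)%N by rewrite ltnNge kV.
by apply: solve_small sol => // S sS hS; apply: nS; exists S.
Qed.

(** As long as two pieces are adjacent, a step strictly lowers the number of pieces; only partitions
    without adjacent pieces remain to be examined. *)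
Lemma solve_of_no_adj :
  (forall P, finset.partition P [set: V] -> (forall A B, ~~ adj P A B) -> P = [set [set: V]]) ->
  solve Epuz sigma 1 None E.
Proof.
move=> stuck.
suff H n P : (#|P| < n)%N -> finset.partition P [set: V] ->
    exists t, iter t step P = [set [set: V]].
  exact: (H _ _ (leqnn _) partition_singletons).
elim: n P => // n IHn P Pn pP.
case: (pselect (exists A B, adj P A B)) => [[A [B AB]]|nAB]; last first.
  exists 0%N; apply: stuck => // A B; apply/negP => AB; apply: nAB; by exists A, B.
have [t tP] : exists t, iter t step (step P) = [set [set: V]].
  apply: IHn; last exact: partition_step.
  rewrite ltnS in Pn; apply: leq_trans Pn; rewrite ltn_neqAle leq_imset_card andbT.
  apply/negP => /imset_injP inj; case/and4P: (AB) => AP BP /eqP + _; apply; apply: inj => //.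
  congr (finset.cover _); rewrite -/(comp P A) -/(comp P B); apply: comp_eq.
  exact: connect1.
by exists t.+1; rewrite iterSr.
Qed.

Lemma no_adj_closed P W u v : finset.partition P [set: V] -> (forall A B, ~~ adj P A B) ->
  W \in P -> u \in W -> [set v; u] \in Epuz ->
  ([set v; u] \in E \/ (sigma <= nb_neighbors E v W)%N) -> v \in W.
Proof.
move=> pP stuck WP uW vu h; apply: contraT => vW.
have /bigcupP[W' W'P vW'] : v \in finset.cover P.
  by case/and3P: pP => /eqP -> _ _; rewrite inE.
have := stuck W' W; rewrite /piece_adj WP W'P /=.
have -> : W' != W by apply: contraNneq vW => <-.
rewrite /= /J2 /=; case: h => h.
  suff -> : J1 Epuz E W' W by [].
  by apply/exists_inP; exists v => //; apply/exists_inP; exists u; rewrite // inE h.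
suff -> : J3 Epuz sigma 1 E W' W by rewrite orbT.
apply/exists_inP; exists v => //; rewrite h /= /link /nb_neighbors card_gt0.
apply/set0Pn; exists u; rewrite inE uW vu andbT /=.
by apply: contraNneq vW => <-.
Qed.

Lemma no_adj_full P W : finset.partition P [set: V] -> W \in P -> W = [set: V] -> P = [set [set: V]].
Proof.
move=> /and3P[_ /finset.trivIsetP tP nP] WP WT; apply/eqP.
rewrite finset.eqEsubset finset.sub1set -WT WP andbT; apply/fintype.subsetP => W' W'P.
rewrite inE; apply: contraT => /(tP _ _ W'P WP); rewrite WT => /pred0P h.
have /set0Pn[x xW'] : W' != finset.set0 by apply: contraNneq nP => <-.
by have := h x; rewrite /= inE xW'.
Qed.

End Dynamics.

(** * From spanned sets on the ring to intervals *)

Section Ring.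
Variables (n sigma : nat).

Definition ring_arc (a : 'I_n) (i : nat) : 'I_n := iter i (@ordS n) a.

Lemma arcS a i : ring_arc a i.+1 = ordS (ring_arc a i). Proof. by []. Qed.

Lemma arcD a i j : ring_arc (ring_arc a i) j = ring_arc a (i + j).
Proof. by rewrite /ring_arc addnC iterD. Qed.

Lemma val_arc a i : val (ring_arc a i) = ((a + i) %% n)%N.
Proof.
elim: i => [|i IHi]; first by rewrite addn0 modn_small.
by rewrite arcS /= -[nat_of_ord _]/(val _) IHi -addn1 modnDml addn1 addnS.
Qed.

Lemma arc_inj a : {in gtn n &, injective (ring_arc a)}.
Proof.
move=> i j; rewrite !inE => i_n j_n /(congr1 val); rewrite !val_arc => /eqP.
by rewrite eqn_modDl !modn_small // => /eqP.
Qed.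

Lemma arc_surj (a v : 'I_n) : exists2 i, (i < n)%N & v = ring_arc a i.
Proof.
have n0 : (0 < n)%N by apply: leq_ltn_trans (ltn_ord a).
exists ((v + (n - a)) %% n)%N; first by rewrite ltn_mod.
apply: val_inj; rewrite val_arc modnDmr addnA [(a + v)%N]addnC -addnA subnKC; last exact: ltnW.
by rewrite modnDr modn_small.
Qed.

Variable E : {set {set 'I_n}}.

Lemma sp_shift (c c' : nat -> 'I_n) k x y : (forall i, c' i = c (k + i)%N) ->
  sp sigma c' E x y -> sp sigma c E (k + x) (k + y).
Proof.
move=> cc'; have vsE x' y' : vs c' x' y' = vs c (k + x') (k + y').
  apply/setP => v; apply/vsP/vsP => -[i ixy ->].
    by exists (k + i)%N => //; lia.
  exists (i - k)%N; first by lia.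
  by rewrite cc'; congr c; lia.
elim=> {x y} [x|x y z xy IHx yz IHy g]; first by rewrite addnS; apply: sp1.
apply: sp_merge IHx IHy _; have y0 : (0 < y)%N by apply: leq_ltn_trans (sp_lt xy).
have e : ((k + y).-1 = k + y.-1)%N by lia.
by rewrite /merge_cond e -!vsE -!cc'.
Qed.

(** Disjointness locates the contact: unless [v] ends the first arc, its successor [w] belongs to
    that arc too; unless [w] starts the second, its predecessor [v] belongs to it. *)
Lemma arc_merge a b m m' v w : (0 < m)%N -> (0 < m')%N ->
  [disjoint vs (ring_arc a) 0 m & vs (ring_arc b) 0 m'] ->
  v \in vs (ring_arc a) 0 m -> w \in vs (ring_arc b) 0 m' -> w = ordS v ->
  sp sigma (ring_arc a) E 0 m -> sp sigma (ring_arc b) E 0 m' ->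
  [\/ [set v; w] \in E, (sigma <= nb_neighbors E v (vs (ring_arc b) 0 m'))%N |
     (sigma <= nb_neighbors E w (vs (ring_arc a) 0 m))%N] ->
  vs (ring_arc a) 0 m :|: vs (ring_arc b) 0 m' = vs (ring_arc a) 0 (m + m') /\ sp sigma (ring_arc a) E 0 (m + m').
Proof.
move=> m0 m'0 dis vA wB wv spA spB g.
have disx x : x \in vs (ring_arc a) 0 m -> x \in vs (ring_arc b) 0 m' -> False.
  by move=> xA xB; move/pred0P/(_ x): dis; rewrite /= xA xB.
have [i im vi] := vsP _ _ _ _ vA.
have {im}im : i = m.-1.
  apply/eqP; apply: contraT => im'; exfalso; apply: (disx w) => //.
  by rewrite wv vi -arcS; apply: mem_vs; lia.
have [j jm wj] := vsP _ _ _ _ wB.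
have {jm}jm : j = 0%N.
  case: j jm wj => // j jm; rewrite wv arcS => /(bij_inj (@ordS_bij n)) vj.
  by exfalso; apply: (disx v) => //; rewrite vj; apply: mem_vs; lia.
have be : b = ring_arc a m.
  by rewrite -(prednK m0) arcS -im -vi -wv wj jm.
have arcb k : ring_arc b k = ring_arc a (m + k) by rewrite be arcD.
have vsb : vs (ring_arc b) 0 m' = vs (ring_arc a) m (m + m').
  apply/setP => x; apply/vsP/vsP => -[k km ->].
    by exists (m + k)%N; [lia|exact: arcb].
  by exists (k - m)%N; [lia|rewrite arcb; congr ring_arc; lia].
split.
  rewrite vsb; apply/setP => x; rewrite finset.in_setU; apply/orP/vsP => [[/vsP|/vsP]|] [k km ->].
  - by exists k => //; lia.
  - by exists k => //; lia.
  - by have [km'|km'] := ltnP k m; [left|right]; apply: mem_vs; lia.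
have := sp_shift arcb spB; rewrite addn0 => spB'.
apply: sp_merge spA spB' _; move: g.
have -> : v = ring_arc a m.-1 by rewrite vi im.
have -> : w = ring_arc a m by rewrite wj jm -be.
by rewrite vsb.
Qed.

Lemma ring_puzzleP (v w : 'I_n) : v != w -> [set v; w] \in ring_puzzle n ->
  w = ordS v \/ v = ordS w.
Proof.
move=> vw /imsetP[i _ e].
have := finset.set21 v w; rewrite e finset.in_set2 => vi.
have := finset.set22 v w; rewrite e finset.in_set2 => wi.
case/orP: vi wi vw => /eqP -> /orP[] /eqP ->; rewrite ?eqxx //; by [left|right].
Qed.

Lemma ispan_arc S : ispan (ring_puzzle n) sigma E S ->
  exists a, S = vs (ring_arc a) 0 #|S| /\ sp sigma (ring_arc a) E 0 #|S|.
Proof.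
elim=> {S} [v|A B _ [a [eA spA]] _ [b [eB spB]] dis [v [w [vA wB vw h]]]].
  exists v; rewrite cards1; split; last exact: sp1.
  apply/setP => x; rewrite inE; apply/eqP/vsP => [->|[[|i] // _ ->] //].
  by exists 0%N.
have cAB : #|A :|: B| = (#|A| + #|B|)%N.
  by rewrite cardsU; move: dis; rewrite -finset.setI_eq0 => /eqP ->; rewrite cards0 subn0.
have v_w : v != w.
  by apply/eqP => e; move/pred0P/(_ v): dis; rewrite /= vA e wB.
have A0 : (0 < #|A|)%N by apply/card_gt0P; exists v.
have B0 : (0 < #|B|)%N by apply/card_gt0P; exists w.
rewrite cAB; case: (ring_puzzleP v_w vw) => e.
  exists a; have := @arc_merge a b #|A| #|B| v w A0 B0.
  by rewrite -eA -eB => /(_ dis vA wB e spA spB h).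
exists b; have := @arc_merge b a #|B| #|A| w v B0 A0.
rewrite -eA -eB disjoint_sym [(#|B| + _)%N]addnC => /(_ dis wB vA e spB spA).
rewrite [A :|: B]finset.setUC; apply.
by case: h => h; [apply: Or31; rewrite finset.setUC|apply: Or33|apply: Or32].
Qed.

Lemma solve_sp k : (2 <= k <= n)%N -> solve (ring_puzzle n) sigma 1 None E ->
  exists a, exists2 m, (k <= m < 2 * k)%N & sp sigma (ring_arc a) E 0 m.
Proof.
move=> kn sol; have [|S spS Sk] := solve_ispan (k := k) _ sol; first by rewrite card_ord.
have [a [_ h]] := ispan_arc spS.
by exists a, #|S|.
Qed.

Lemma ring_edge (a : 'I_n) i : [set ring_arc a i.+1; ring_arc a i] \in ring_puzzle n.
Proof. by apply/imsetP; exists (ring_arc a i) => //; rewrite finset.setUC. Qed.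

(** In a partition without adjacent pieces, the piece of [a] must contain the arc vertex by vertex:
    the first [L] by the seed conditions, the others, all the way round, by their contact with the
    first [L]. *)
Lemma solve_of_seed (a : 'I_n) L : (0 < L <= n)%N ->
  (forall i, (i.+1 < L)%N -> [set ring_arc a i.+1; ring_arc a i] \in E \/
     (sigma <= nb_neighbors E (ring_arc a i.+1) (vs (ring_arc a) 0 i.+1))%N) ->
  (forall v, v \notin vs (ring_arc a) 0 L -> (sigma <= nb_neighbors E v (vs (ring_arc a) 0 L))%N) ->
  solve (ring_puzzle n) sigma 1 None E.
Proof.
move=> L0n seed out; apply: solve_of_no_adj => P pP stuck.
have /bigcupP[W WP aW] : a \in finset.cover P.
  by case/and3P: pP => /eqP -> _ _; rewrite inE.
have sub i : (forall j, (j < i)%N -> ring_arc a j \in W) -> vs (ring_arc a) 0 i \subset W.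
  by move=> h; apply/fintype.subsetP => v /vsP[j ji ->]; apply: h.
have step i : (forall j, (j <= i)%N -> ring_arc a j \in W) -> (i.+1 < n)%N -> ring_arc a i.+1 \in W.
  move=> h i_n; apply: (no_adj_closed pP stuck WP (h i (leqnn i)) (ring_edge a i)).
  have [iL|Li] := ltnP i.+1 L.
    case: (seed i iL) => h'; [by left|right].
    by apply: leq_trans h' _; apply: leq_nb_neighbors => //; apply: sub => j; rewrite ltnS; apply: h.
  have iL : ring_arc a i.+1 \notin vs (ring_arc a) 0 L.
    have Ln : (L <= n)%N by case/andP: L0n.
    by apply/negP => /(vs_notin (@arc_inj a) Ln i_n); lia.
  right; apply: (leq_trans (out _ iL)); apply: leq_nb_neighbors => //; apply: sub => j jL; apply: h; lia.
have all_in i : (i < n)%N -> ring_arc a i \in W.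
  elim/ltn_ind: i => -[|i] IHi i_n //; apply: step => // j ji; apply: IHi; lia.
apply: (no_adj_full pP WP); apply/setP => v; rewrite inE.
by have [i i_n ->] := arc_surj a v; apply: all_in.
Qed.

End Ring.

(** * The random graph as a Bernoulli product *)

Section ErdosRenyi.
Variables (R : realType) (V : finType).

Lemma er_probE (p : R) (A : {set {set V}} -> Prop) : er_prob p A = Pr (ew (edge_prob p)) A.
Proof.
rewrite /er_prob /Pr /Ex big_mkcond /=; apply: eq_bigr => E _.
case: ifP => [/andP[EP AE]|]; last first.
  case: asboolP => _; rewrite ?mulr0 // andbT => /negbT/fintype.subsetPn[e eE eP].
  by rewrite mulr1 /wt (bigD1 e) //= eE /ew (negbTE eP) mul0r.
rewrite AE mulr1 /wt [RHS](bigID (mem (pairs V))) /= [X in _ = _ * X]big1 ?mulr1.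
  by apply: eq_bigr => e eP; rewrite /ew eP.
move=> e eP; rewrite /ew (negbTE eP) ifN ?subr0 //.
by apply: contra eP; apply: (fintype.subsetP EP).
Qed.

Lemma edge_prob01 (p : R) : 0 <= edge_prob p <= 1.
Proof. by rewrite /edge_prob le_min ge_min lexx ler01 le_max lexx. Qed.

Lemma edge_prob_homo (p p' : R) : p <= p' -> edge_prob p <= edge_prob p'.
Proof.
move=> pp'; rewrite /edge_prob; apply: le_min2 => //; apply: le_max2 => //.
Qed.

Lemma edge_probE (p : R) : 0 <= p <= 1 -> edge_prob p = p.
Proof. by case/andP=> p0 p1; rewrite /edge_prob (max_idPr _) // (min_idPr _). Qed.

Lemma ew_homo (p p' : R) e : p <= p' -> @ew R V p e <= ew p' e.
Proof. by rewrite /ew; case: ifP. Qed.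

End ErdosRenyi.

(** * The constant lambda *)

Section DecreasingIntegral.
Local Open Scope classical_set_scope.
Variables (R : realType) (h : R -> R).
Hypotheses (h_meas : measurable_fun [set: R] h)
  (h_ge0 : forall x : R, 0 < x -> 0 <= h x)
  (h_noninc : forall x y : R, 0 < x -> x <= y -> h y <= h x).

(** Open on the left: adjacent intervals are disjoint, and the endpoint 0, where [h] may be
    singular, can serve as [a]. *)
Definition itv_int (a b : R) : \bar R :=
  (\int[@lebesgue_measure R]_(x in `]a, b]) (h x)%:E)%E.

Let h_measE (D : set R) : measurable_fun D (EFin \o h).
Proof. by apply/measurable_EFinP; apply: measurable_funTS. Qed.

Let itv_cst (a b c : R) : a <= b ->
  (\int[@lebesgue_measure R]_(x in `]a, b]) (cst c%:E) x)%E = ((b - a) * c)%:E.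
Proof.
move=> ab; rewrite integral_cst; last exact: measurable_itv.
rewrite /= lebesgue_measure_itv /= lte_fin; case: ltP => ba.
  by rewrite -EFinB -EFinM mulrC.
by rewrite mule0 (_ : b = a) ?subrr ?mul0r //; apply/eqP; rewrite eq_le ba ab.
Qed.

Lemma itv_int_ge (a b : R) : 0 <= a -> a < b -> (((b - a) * h b)%:E <= itv_int a b)%E.
Proof.
move=> a0 ab; rewrite -(itv_cst _ (ltW ab)); apply: ge0_le_integral => //.
- by move=> x _; rewrite lee_fin h_ge0 // (le_lt_trans a0).
- exact: h_measE.
- move=> x /=; rewrite in_itv /= => /andP[ax xb]; rewrite lee_fin h_noninc //.
  exact: le_lt_trans ax.
Qed.

Lemma itv_int_le (a b : R) : 0 < a -> a <= b -> (itv_int a b <= ((b - a) * h a)%:E)%E.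
Proof.
move=> a0 ab; rewrite -itv_cst //; apply: ge0_le_integral => //.
- move=> x /=; rewrite in_itv /= => /andP[ax _].
  by rewrite lee_fin h_ge0 // (lt_trans a0).
- exact: h_measE.
- move=> x /=; rewrite in_itv /= => /andP[ax xb]; rewrite lee_fin h_noninc //.
  exact: ltW.
Qed.

Lemma itv_int_cat (a b c : R) : 0 <= a -> a <= b -> b <= c ->
  itv_int a c = (itv_int a b + itv_int b c)%E.
Proof.
move=> a0 ab bc; rewrite /itv_int -ge0_integral_setU //=.
- by rewrite -itv_bndbnd_setU // bnd_simp.
- exact: h_measE.
- move=> x [] /=; rewrite in_itv /= => /andP[ax _]; rewrite lee_fin h_ge0 //.
    exact: le_lt_trans ax.
  by apply: le_lt_trans ax; apply: le_trans ab.
- apply/disj_setPS => x [] /=; rewrite !in_itv /= => /andP[_ xb] /andP[bx _].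
  by move: (lt_le_trans bx xb); rewrite ltxx.
Qed.

Lemma itv_int_ge0 (a b : R) : 0 <= a -> (0 <= itv_int a b)%E.
Proof.
move=> a0; apply: integral_ge0 => x /=; rewrite in_itv /= => /andP[ax _].
by rewrite lee_fin h_ge0 // (le_lt_trans a0).
Qed.

Lemma itv_int_sub (a b c d : R) : 0 <= c -> c <= a -> b <= d -> (itv_int a b <= itv_int c d)%E.
Proof.
move=> c0 ca bd; apply: ge0_subset_integral => //.
- exact: h_measE.
- move=> x /=; rewrite in_itv /= => /andP[cx _].
  by rewrite lee_fin h_ge0 // (le_lt_trans c0).
- move=> x /=; rewrite !in_itv /= => /andP[ax xb].
  by rewrite (le_lt_trans ca ax) (le_trans xb bd).
Qed.

Lemma lower_sum_le (q : R) J : 0 < q ->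
  ((q * \sum_(0 <= j < J) h (q * j.+1%:R))%:E <= itv_int 0 (q * J%:R))%E.
Proof.
move=> q0; elim: J => [|J IHJ].
  by rewrite big_geq // mulr0 itv_int_ge0.
have qJ : 0 <= q * J%:R by rewrite mulr_ge0 // ltW.
have e : q * J.+1%:R = q * J%:R + q by rewrite -natr1 mulrDr mulr1.
rewrite (@itv_int_cat _ (q * J%:R)) //; last by rewrite e lerDl ltW.
rewrite big_nat_recr //= mulrDr EFinD leeD //.
apply: le_trans (itv_int_ge qJ _); last by rewrite e ltrDl.
by rewrite e addrAC subrr add0r.
Qed.

Lemma upper_sum_ge (a q : R) k : 0 < a -> 0 < q ->
  (itv_int a (a + q * k%:R) <= (q * \sum_(0 <= j < k) h (a + q * j%:R))%:E)%E.
Proof.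
move=> a0 q0; elim: k => [|k IHk].
  rewrite big_geq // mulr0 addr0; apply: le_trans (itv_int_le a0 (lexx _)) _.
  by rewrite subrr mul0r.
have aqk : 0 < a + q * k%:R by rewrite ltr_pwDl // mulr_ge0 // ltW.
have e : a + q * k.+1%:R = a + q * k%:R + q by rewrite -natr1 mulrDr mulr1 addrA.
rewrite (@itv_int_cat _ (a + q * k%:R)); [|exact: ltW| |]; last 2 first.
- by rewrite lerDl mulr_ge0 // ltW.
- by rewrite e lerDl ltW.
rewrite big_nat_recr //= mulrDr EFinD leeD //.
apply: le_trans (itv_int_le aqk _) _; first by rewrite e lerDl ltW.
by rewrite e addrAC subrr add0r.
Qed.

End DecreasingIntegral.

(** * Finiteness, positivity and Riemann sums of the constant *)

Section Lambda.
Local Open Scope classical_set_scope.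
Variables (R : realType) (s : nat).
Hypothesis s1 : (1 <= s)%N.

(* The function g_sigma of the paper, real-valued; junk at x <= 0. *)
Definition gr (x : R) : R := - ln (phi s x).

Lemma expR_gr x : 0 < x -> expR (- gr x) = phi s x.
Proof. by move=> x0; rewrite opprK lnK // posrE phi_gt0. Qed.

Lemma gr_ge0 x : 0 < x -> 0 <= gr x.
Proof. by move=> x0; rewrite oppr_ge0 ln_le0 // phi_le1 // ltW. Qed.

Lemma gr_gt0 x : 0 < x -> 0 < gr x.
Proof.
move=> x0; rewrite oppr_gt0 ln_lt0 // phi_gt0 //=; move: s1; case: (s) => // s' _.
by rewrite phiS_lt1 // ltW.
Qed.

Lemma gr_noninc x y : 0 < x -> x <= y -> gr y <= gr x.
Proof.
move=> x0 xy; rewrite lerN2 ler_ln ?posrE ?phi_gt0 //; first by rewrite phi_homo // ltW.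
exact: lt_le_trans xy.
Qed.

Lemma gr_meas : measurable_fun [set: R] gr.
Proof.
apply: measurableT_comp => //; apply: measurableT_comp; first exact: measurable_ln.
apply: continuous_measurable_fun => x; case: (s) => [|s'] /=; first exact: cst_continuous.
rewrite -/(phi s'.+1).
apply: differentiable_continuous; apply/derivable1_diffP.
by have d := is_derive_phi s' x; apply: ex_derive.
Qed.

Lemma poisson_prob_phi (x : R) : 0 < x ->
  poisson_prob x 0 [set k | (s <= k)%N] = (phi s x)%:E.
Proof.
move=> x0.
have -> : [set k | (s <= k)%N] = ~` `I_s.
  by apply/seteqP; split => k /=; rewrite leqNgt => /negP; rewrite ?negbK.
have := @probability_setC _ _ R (poisson_prob x 0) `I_s.
move=> -> //; transitivity (1 - poisson_prob x 0 `I_s)%E => //.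
rewrite /poisson_prob x0 esum_fset //; last first.
  by move=> i _; rewrite lee_fin poisson_pmf_ge0.
rewrite -fsbig_ord sumEFin -EFinB phiE; congr (1 - _)%:E; apply: eq_bigr => i _.
by rewrite /poisson_pmf x0.
Qed.

Lemma g_E (x : R) : 0 < x -> g_ s x = (gr x)%:E.
Proof. by move=> x0; rewrite /g_ poisson_prob_phi // lne_EFin // phi_gt0. Qed.

Let I := itv_int gr.
Let F (n : nat) : set R := `]n.+1%:R^-1, n.+1%:R].

Let gm (D : set R) : measurable_fun D (EFin \o gr).
Proof. by apply/measurable_EFinP; apply: measurable_funTS; apply: gr_meas. Qed.

Lemma lambda_int :
  lambda_ R s = (\int[@lebesgue_measure R]_(x in `]0%R, +oo[) (EFin \o gr) x)%E.
Proof.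
have gm' : measurable_fun (`]0%R, +oo[ : set R) (g_ s : R -> \bar R).
  apply: (eq_measurable_fun (EFin \o gr)) => // x.
  by rewrite inE /= in_itv /= andbT => x0; rewrite g_E.
rewrite /lambda_ -integral_itv_obnd_cbnd //; apply: eq_integral => x.
by rewrite inE /= in_itv /= andbT => /g_E.
Qed.

(** Monotone convergence along bounded windows away from 0; the singularity at 0 and the tail can
    then be bounded separately. *)
Lemma lambda_sup : lambda_ R s = ereal_sup (range (fun n => I n.+1%:R^-1 n.+1%:R)).
Proof.
rewrite lambda_int.
have Fpos n x : F n x -> 0 < x.
  rewrite /F /= in_itv /= => /andP[h _]; apply: le_lt_trans h; by rewrite invr_ge0.
have -> : `]0%R, +oo[ = \bigcup_n F n.
  apply/seteqP; split => x /=; rewrite ?in_itv /= ?andbT; last by case=> n _ /Fpos.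
  move=> x0; exists (Num.truncn x + Num.truncn x^-1)%N => //.
  rewrite /F /= in_itv /=; apply/andP; split.
    rewrite -[ltRHS]invrK ltf_pV2 ?posrE ?invr_gt0 //.
    by apply: lt_le_trans (truncnS_gt x^-1) _; rewrite ler_nat ltnS leq_addl.
  by apply: ltW; apply: lt_le_trans (truncnS_gt x) _; rewrite ler_nat ltnS leq_addr.
have ndF : {homo F : n m / (n <= m)%N >-> (n <= m)%O}.
  move=> n m nm; apply/subsetPset => x; rewrite /F /= !in_itv /= => /andP[h1 h2].
  apply/andP; split; last by apply: le_trans h2 _; rewrite ler_nat.
  by apply: le_lt_trans h1; rewrite lef_pV2 ?posrE // ler_nat.
have ge0F n x : F n x -> (0 <= (gr x)%:E)%E by move=> /Fpos x0; rewrite lee_fin gr_ge0.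
have c1 : (I n.+1%:R^-1 n.+1%:R @[n --> \oo] -->
    \int[@lebesgue_measure R]_(x in \bigcup_n F n) (EFin \o gr) x)%E.
  by apply: ge0_nondecreasing_set_cvg_integral => // n; apply: gm.
have nd : nondecreasing_seq (fun n => I n.+1%:R^-1 n.+1%:R).
  move=> n m nm; apply: (itv_int_sub gr_meas gr_ge0); rewrite ?invr_ge0 //.
    by rewrite lef_pV2 ?posrE // ler_nat.
  by rewrite ler_nat.
have c2 := ereal_nondecreasing_cvgn nd.
exact: (cvg_unique _ c1 c2).
Qed.

(** The single weight [pois s] already shows that g grows only logarithmically at 0, hence linearly
    in [k] along the powers of 1/2. *)
Lemma gr_le_near0 k : gr (2 ^- k : R) <= (1 + ln s`!%:R + s%:R) * (k.+1%:R).
Proof.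
have x0 : 0 < 2 ^- k :> R by rewrite invr_gt0 exprn_gt0.
have f1 : 1 <= s`!%:R :> R by rewrite (ler_nat R 1) fact_gt0.
have f0 : 0 < s`!%:R :> R by apply: lt_le_trans f1.
have : - ln (pois s (2 ^- k : R)) <= 1 + ln s`!%:R + s%:R * k%:R.
  rewrite /pois !lnM ?posrE ?mulr_gt0 ?exprn_gt0 ?invr_gt0 ?expR_gt0 //.
  rewrite lnXn // !lnV ?posrE ?exprn_gt0 // lnXn // expRK.
  have ln2 : ln 2 <= 1 :> R by have := @le_ln1Dx R 1; rewrite -[1 + 1]/(2%:R); apply; lra.
  have x1 : 2 ^- k <= 1 :> R by rewrite invf_le1 ?exprn_gt0 // exprn_ege1 //; lra.
  rewrite -[_ *+ k]mulr_natl -[_ *+ s]mulr_natl; have k0 : 0 <= k%:R :> R := ler0n R k.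
  have : s%:R * (k%:R * ln 2) <= s%:R * k%:R :> R.
    by apply: ler_wpM2l => //; apply: ler_piMr.
  lra.
have : ln (pois s (2 ^- k)) <= ln (phi s (2 ^- k)) :> R.
  by rewrite ler_ln ?posrE ?pois_gt0 ?phi_gt0 // pois_le_phi // ltW.
have l0 : 0 <= ln s`!%:R :> R by rewrite ln_ge0.
have : 0 <= ln s`!%:R * k%:R :> R by rewrite mulr_ge0.
have : 0 <= k%:R :> R := ler0n R k.
have : 0 <= s%:R :> R := ler0n R s.
by rewrite /gr -natr1; lra.
Qed.

(** The k-th dyadic interval contributes at most a constant times [(k + 1) / 2 ^ k]; the sum of
    these terms for [k] from 1 to [N] is [3 - (N + 3) / 2 ^ N]. *)
Lemma I_near0 N : (I (2 ^- N) 1 <= ((1 + ln s`!%:R + s%:R) * (3 - (N + 3)%:R * 2 ^- N))%:E)%E.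
Proof.
set C := 1 + _ + _.
elim: N => [|N IHN].
  rewrite expr0 invr1 add0n mulr1 subrr mulr0.
  apply: le_trans (itv_int_le gr_meas gr_ge0 gr_noninc _ _) _ => //.
  by rewrite subrr mul0r.
have x0 k : 0 < 2 ^- k :> R by rewrite invr_gt0 exprn_gt0.
have e : 2 ^- N = 2 * 2 ^- N.+1 :> R.
  by rewrite exprS invfM mulrA mulfV ?mul1r // pnatr_eq0.
have x1 : 2 ^- N <= 1 :> R by rewrite invf_le1 ?exprn_gt0 // exprn_ege1 //; lra.
rewrite /I (@itv_int_cat _ gr gr_meas gr_ge0 _ (2 ^- N) _); [|exact: ltW| |exact: x1]; last first.
  by rewrite e; have := x0 N.+1; lra.
apply: le_trans (leeD (itv_int_le gr_meas gr_ge0 gr_noninc _ _) IHN) _ => //.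
  by rewrite e; have := x0 N.+1; lra.
rewrite -EFinD lee_fin.
have h := gr_le_near0 N.+1; rewrite -/C in h.
have := ler_wpM2l (ltW (x0 N.+1)) h.
rewrite !natrD e -!natr1; set G := gr _; move: (2 ^- N.+1 : R) (N%:R : R) => y z.
lra.
Qed.

(** From [- ln u <= u^-1 - 1] and [phi_tail], the upper sum is dominated by a geometric series of
    ratio [expR (- 2^-1)]. *)
Lemma I_tail k : (I 1 (1 + k%:R) <=
  (2 ^+ s / phi s 1 * (1 - expR (- 2^-1))^-1)%:E)%E.
Proof.
have := upper_sum_ge gr_meas gr_ge0 gr_noninc k (@ltr01 R) (@ltr01 R).
rewrite mul1r => /le_trans; apply; rewrite lee_fin mul1r.
set r := expR (- 2^-1); have r1 : 0 < 1 - r by rewrite subr_gt0 expR_lt1; lra.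
have p1 : 0 < phi s 1 :> R by apply: phi_gt0.
have gj j : gr (1 + 1 * j%:R) <= 2 ^+ s / phi s 1 * r ^+ j.
  rewrite mul1r; set x := 1 + j%:R; have x1 : 1 <= x by rewrite lerDl.
  have x0 : 0 < x by lra.
  have px : phi s 1 <= phi s x by apply: phi_homo.
  have px0 : 0 < phi s x by apply: phi_gt0.
  have le1 : gr x <= (1 - phi s x) / phi s x.
    rewrite /gr -lnV ?posrE // mulrBl mul1r mulfV ?gt_eqF //.
    have := @le_ln1Dx R ((phi s x)^-1 - 1); rewrite [1 + _]addrC subrK; apply.
    by rewrite ltrBrDr addNr invr_gt0.
  apply: le_trans le1 _; rewrite mulrAC; apply: ler_pM.
  - by rewrite subr_ge0 phi_le1 // ltW.
  - by rewrite invr_ge0 ltW.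
  - apply: le_trans (phi_tail s (ltW x0)) _; apply: ler_wpM2l; first by rewrite exprn_ge0.
    by rewrite /r -expRM_natl ler_expR /x; have : 0 <= j%:R :> R := ler0n R j; lra.
  - by rewrite lef_pV2 ?posrE.
apply: le_trans (ler_sum _ (fun j _ => gj j)) _; rewrite -mulr_sumr.
apply: ler_wpM2l; first by rewrite mulr_ge0 ?exprn_ge0 ?invr_ge0 ?(ltW p1).
have -> : \sum_(0 <= j < k) r ^+ j = (1 - r ^+ k) / (1 - r).
  apply: (canRL (mulfK _)); first by rewrite gt_eqF.
  elim: k => [|k IHk]; first by rewrite big_geq // mul0r subrr.
  by rewrite big_nat_recr //= mulrDl IHk exprS; ring.
by rewrite -[leRHS]mul1r ler_wpM2r ?invr_ge0 ?(ltW r1) // gerBl exprn_ge0 // expR_ge0.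
Qed.

Definition lam : R := fine (lambda_ R s).

Lemma lambdaE : lambda_ R s = lam%:E.
Proof.
rewrite /lam fineK // ge0_fin_numE; last first.
  by rewrite lambda_int; apply: integral_ge0 => x /=; rewrite in_itv /= andbT lee_fin; apply: gr_ge0.
set C1 : R := (1 + ln s`!%:R + s%:R) * 3.
set C2 : R := 2 ^+ s / phi s 1 * (1 - expR (- 2^-1))^-1.
apply: le_lt_trans (ltry (C1 + C2)); rewrite lambda_sup; apply: ub_ereal_sup => _ [n _ <-].
have n2 : 2 ^- n <= n.+1%:R^-1 :> R.
  by rewrite lef_pV2 ?posrE ?exprn_gt0 // -natrX ler_nat ltn_expl.
have n1 : 2 ^- n <= 1 :> R by rewrite invf_le1 ?exprn_gt0 // exprn_ege1 //; lra.
have n0 : 0 <= 2 ^- n :> R by rewrite invr_ge0 exprn_ge0.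
apply: le_trans (itv_int_sub gr_meas gr_ge0 n0 n2 (lexx _)) _.
have e : n.+1%:R = 1 + n%:R :> R by rewrite -natr1 addrC.
rewrite (@itv_int_cat _ gr gr_meas gr_ge0 _ 1) //; last by rewrite e lerDl.
rewrite EFinD; apply: leeD; last by rewrite e; apply: I_tail.
apply: le_trans (I_near0 n) _; rewrite lee_fin; apply: ler_wpM2l.
  by rewrite !addr_ge0 // ln_ge0 // (ler_nat R 1) fact_gt0.
by rewrite gerBl mulr_ge0.
Qed.

Lemma lam_gt0 : 0 < lam.
Proof.
rewrite -lte_fin -lambdaE lambda_sup; apply: lt_le_trans (_ : (I 2^-1 2 <= _)%E); last first.
  by apply: ereal_sup_ubound; exists 1%N.
apply: lt_le_trans (itv_int_ge gr_meas gr_ge0 gr_noninc _ _); rewrite ?lte_fin ?mulr_gt0 ?gr_gt0 //; lra.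
Qed.

Lemma lower_sum_lam (q : R) J : 0 < q -> q * \sum_(0 <= j < J) gr (q * j.+1%:R) <= lam.
Proof.
move=> q0; rewrite -lee_fin -lambdaE lambda_int.
apply: le_trans (lower_sum_le gr_meas gr_ge0 gr_noninc J q0) _.
apply: ge0_subset_integral => //.
- exact: gm.
- by move=> x /=; rewrite in_itv /= andbT lee_fin; apply: gr_ge0.
- by move=> x /=; rewrite !in_itv /= andbT => /andP[].
Qed.

(** Truncation at [eta] makes the integrand bounded, so one pair [eta], [K] serves all small [q]:
    the upper sum of the truncated function starts at [q + d <= eta] and reaches past [K]. The shift
    [d] leaves room for the slack in the gap lengths. *)
Lemma lam_approx (eps : R) : 0 < eps -> exists eta K : R, [/\ 0 < eta, eta < K &
  forall (q d : R) k, 0 < q -> 0 <= d -> q + d <= eta -> K <= q * k%:R ->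
  lam - eps <= q * \sum_(0 <= j < k) gr (Num.max (q * j.+1%:R + d) eta)].
Proof.
move=> e0; have : (ereal_sup (range (fun n => I n.+1%:R^-1 n.+1%:R)) \is a fin_num).
  by rewrite -lambda_sup lambdaE.
move=> /(ub_ereal_sup_adherent e0)[_ [n _ <-]]; rewrite -lambda_sup lambdaE -EFinB => lt_I.
(* [n.+2] instead of [n.+1] keeps [eta < K] when [n = 0]. *)
pose eta : R := n.+2%:R^-1; pose K : R := n.+1%:R.
have eta0 : 0 < eta by rewrite invr_gt0.
have eta_n : eta <= n.+1%:R^-1 by rewrite lef_pV2 ?posrE // ler_nat.
have etaK : eta < K.
  have : n.+2%:R^-1 < 1 :> R by rewrite invf_lt1 ?ltr1n ?ltr0n.
  have : 1 <= n.+1%:R :> R by rewrite ler1n.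
  by move=> h1 h2; apply: lt_le_trans h2 h1.
exists eta, K; split=> // q d k q0 d0 qd Kk.
pose h x := gr (Num.max x eta).
have hm : measurable_fun [set: R] h.
  by apply: measurableT_comp; [exact: gr_meas|apply: measurable_maxr].
have max0 x : 0 < Num.max x eta by rewrite lt_max eta0 orbT.
have h0 x : 0 < x -> 0 <= h x by move=> _; apply: gr_ge0.
have hd x y : 0 < x -> x <= y -> h y <= h x.
  by move=> _ xy; apply: gr_noninc => //; rewrite ge_max !le_max xy lexx orbT.
have qd0 : 0 < q + d by lra.
rewrite -lee_fin; apply: le_trans (ltW lt_I) _.
apply: le_trans (_ : (I eta K <= _)%E); first exact: (itv_int_sub gr_meas gr_ge0 (ltW eta0) eta_n (lexx _)).
have -> : I eta K = itv_int h eta K.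
  apply: eq_integral => x; rewrite inE /= in_itv /= => /andP[ex _].
  by rewrite /h (max_idPl _) // ltW.
have := upper_sum_ge hm h0 hd k qd0 q0.
rewrite (eq_bigr (fun j => gr (Num.max (q * j.+1%:R + d) eta))); last first.
  by move=> j _; rewrite /h -natr1 mulrDr mulr1; congr (gr (Num.max _ _)); ring.
move=> /(le_trans _); apply; apply: (itv_int_sub hm h0 (ltW qd0) qd).
by apply: le_trans Kk _; rewrite lerDr ltW.
Qed.

End Lambda.

(** * Solving probabilities on the ring *)

Section RingBounds.
Variables (R : realType) (n sigma : nat).
Hypothesis sigma1 : (1 <= sigma)%N.
Notation slv E := (solve (ring_puzzle n) sigma 1 None E).

(** Spanning is an increasing event, so the estimate at the threshold value [p] serves every smaller
    [p']. *)
Lemma Pr_solve_le (p p' B : R) k : 0 <= p' -> p' <= p -> p <= 1 -> (2 <= k)%N -> (2 * k <= n)%N ->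
  (forall (a : 'I_n) m, (k <= m < 2 * k)%N ->
     Pr (ew p) (fun E => sp sigma (ring_arc a) E 0 m) <= B) ->
  Pr (ew p') (fun E => slv E) <= n%:R * (k%:R * B).
Proof.
move=> p'0 p'p p1 k2 kn spB.
have wP' : proba (@ew R 'I_n p') by apply: ew_proba; rewrite p'0 (le_trans p'p).
have wP : proba (@ew R 'I_n p) by apply: ew_proba; rewrite p1 (le_trans p'0).
pose D (i : 'I_n * nat) (E : {set {set 'I_n}}) := sp sigma (ring_arc i.1) E 0 i.2.
pose r := [seq (a, m) | a <- enum 'I_n, m <- index_iota k (2 * k)].
apply: (@le_trans _ _ (\sum_(i <- r) Pr (ew p') (D i))).
  apply: le_trans (Pr_exists_le _ _ wP'); apply: le_Pr => // E /(solve_sp (k := k)) [|a [m km spE]].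
    by rewrite k2; lia.
  exists (a, m) => //; apply/allpairsP; exists (a, m).
  by rewrite mem_enum mem_index_iota.
apply: (@le_trans _ _ (\sum_(i <- r) B)).
  rewrite ![\sum_(i <- r) _]big_seq; apply: ler_sum => i /allpairsP[[a m] [_ /=]].
  rewrite mem_index_iota => km ->; apply: le_trans (spB a m km).
  apply: Pr_homo_w => //; [by move=> e; apply: ew_homo|exact: sp_incr].
rewrite big_const_seq count_predT iter_addr_0 size_allpairs size_enum_ord size_iota.
by rewrite (_ : 2 * k - k = k)%N; [rewrite -[leLHS]mulr_natl natrM mulrA|lia].
Qed.

Variable a : 'I_n.
Let c := ring_arc a.
Let c_inj : {in gtn n &, injective c}. Proof. exact: arc_inj. Qed.

(* Growth from c x to the right, one vertex at a time: the first sigma vertices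
   are attached by a doubly connected edge, the others by (J3). *)
Definition seed x k (E : {set {set 'I_n}}) : Prop := forall i, (i < k)%N ->
  if (i < sigma)%N then [set c (x + i.+1)%N; c (x + i)%N] \in E
  else (sigma <= nb_neighbors E (c (x + i.+1)%N) (vs c x (x + i.+1)))%N.

Lemma seed_incr x k : increasing (seed x k).
Proof.
move=> E F EF h i ik; have := h i ik; case: ifP => _; first exact: (fintype.subsetP EF).
by move=> /leq_trans; apply; apply: leq_nb_neighbors.
Qed.

Lemma seed_inner x k E : (x + k < n)%N -> seed x k E -> seed x k (E :&: inner c x (x + k.+1)).
Proof.
move=> xk h i ik; have := h i ik; case: ifP => _.
  rewrite inE => -> /=; have := @crossE _ c n c_inj x (x + i.+1) (x + k.+1) (x + i) (x + i.+1).
  rewrite finset.setUC => cr.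
  by apply: (fintype.subsetP (cross_sub c x (x + i.+1) (x + k.+1))); apply: cr; lia.
rewrite nb_neighbors_setI //.
apply: fintype.subset_trans (cross_sub c x (x + i.+1) (x + k.+1)).
by apply: star_cross_r; [exact: c_inj|lia|lia].
Qed.

Variables (p q : R).
Hypotheses (p0 : 0 < p) (p1 : p < 1) (pq : expR (- q) = 1 - p).

Let q0 : 0 < q. Proof. exact: lt_le_trans (rate_ge pq). Qed.
Let wP : proba (@ew R 'I_n p). Proof. by apply: ew_proba; rewrite !ltW. Qed.

(** A vertex facing [k.+1] earlier ones succeeds with probability [bin_tail p k.+1 sigma], at least
    the Poisson tail for [k.+1 - sigma] trials; hence the index shift by [sigma] in the sum. *)
Lemma Pr_seed_aux x k : (x + k < n)%N ->
  p ^+ minn k sigma * expR (- \sum_(0 <= j < k - sigma) gr sigma (q * j.+1%:R)) <=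
  Pr (ew p) (seed x k).
Proof.
elim: k => [|k IHk] xk.
  rewrite min0n sub0n big_geq // oppr0 expR0 expr0 mulr1 Pr_True //.
set A := fun E : {set {set 'I_n}} =>
  if (k < sigma)%N then [set c (x + k.+1)%N; c (x + k)%N] \in E
  else (sigma <= nb_neighbors E (c (x + k.+1)%N) (vs c x (x + k.+1)))%N.
have Ai : increasing A.
  move=> E F EF; rewrite /A; case: ifP => _; first exact: (fintype.subsetP EF).
  by move=> /leq_trans; apply; apply: leq_nb_neighbors.
apply: le_trans (_ : _ <= Pr (ew p) (fun E => seed x k E /\ A E)) _; last first.
  apply: le_Pr => // E [h hA] i; rewrite ltnS leq_eqVlt => /orP[/eqP ->|]; [exact: hA|exact: h].
apply: le_trans (Pr_Harris wP (@seed_incr x k) Ai).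
have {}IHk := IHk ltac:(lia).
have [ks|sk] := ltnP k sigma.
  have -> : Pr (ew p) A = p.
    rewrite /A ks; apply: Pr_edge; rewrite inE cards2.
    have -> // : c (x + k.+1)%N != c (x + k)%N.
    apply/eqP => /c_inj h; have : (x + k.+1 = x + k)%N by apply: h; rewrite inE; lia.
    by lia.
  apply: le_trans (ler_wpM2r (ltW p0) IHk).
  have -> : (k.+1 - sigma = 0)%N by lia.
  have -> : (k - sigma = 0)%N by lia.
  rewrite big_geq // oppr0 expR0 !mulr1 (minn_idPl ks) (minn_idPl (ltnW ks)).
  by rewrite exprSr.
have hA : expR (- gr sigma (q * (k - sigma).+1%:R)) <= Pr (ew p) A.
  rewrite expR_gr //; last by rewrite mulr_gt0.
  rewrite /A ltnNge sk /= Pr_nb_neighbors.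
  have -> : vs c x (x + k.+1) :\ c (x + k.+1)%N = vs c x (x + k.+1).
    apply/setP => v; rewrite finset.in_setD1; case: eqP => //= ->.
    by apply/esym/negbTE/negP => /(vs_notin c_inj); lia.
  rewrite (card_vs_eq c_inj); last by lia.
  have -> : (x + k.+1 - x = k.+1)%N by lia.
  have -> : (k - sigma).+1 = (k.+1 - sigma)%N by lia.
  by apply: phi_le_bin_tail => //; rewrite ltW.
have -> : (k.+1 - sigma = (k - sigma).+1)%N by lia.
rewrite big_nat_recr //= opprD expRD mulrA.
have -> : minn k.+1 sigma = minn k sigma by rewrite (minn_idPr sk) (minn_idPr (leqW sk)).
apply: ler_pM => //.
by rewrite mulr_ge0 ?expR_ge0 // exprn_ge0 // ltW.
Qed.

Definition seed_prob : R := p ^+ sigma * expR (- (lam R sigma / q)).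

(** The lower Riemann sum never exceeds [lam / q], so the bound is uniform in the block length. *)
Lemma Pr_seed x k : (x + k < n)%N -> seed_prob <= Pr (ew p) (seed x k).
Proof.
move=> /Pr_seed_aux; apply: le_trans; apply: ler_pM.
- by rewrite exprn_ge0 // ltW.
- exact: expR_ge0.
- by apply: ler_wiXn2l; [rewrite ltW|rewrite ltW|rewrite geq_minr].
- rewrite ler_expR lerN2 ler_pdivlMr // mulrC; exact: lower_sum_lam.
Qed.

Variable k : nat.
Let L := k.+1.

Definition some_seed N (E : {set {set 'I_n}}) : Prop := exists2 j, (j < N)%N & seed (j * L) k E.

Lemma some_seed_incr N : increasing (some_seed N).
Proof. by move=> E F EF [j jN h]; exists j => //; apply: seed_incr EF h. Qed.

(* Seeds in disjoint blocks are supported on disjoint sets of pairs, so the BK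
   inequality bounds the probability that two of them occur. *)
Lemma Pr_some_seed N : (N * L <= n)%N ->
  1 - Pr (ew p) (some_seed N) <= (1 - seed_prob) ^+ N.
Proof.
elim: N => [|N IHN] NL; first by rewrite expr0 gerBl Pr_ge0.
have NLk : (N * L + k < n)%N by move: NL; rewrite mulSn /L; lia.
have {}IHN := IHN ltac:(lia).
have bk : Pr (ew p) (fun E => some_seed N E /\ seed (N * L) k E) <=
   Pr (ew p) (some_seed N) * Pr (ew p) (seed (N * L) k).
  apply: le_trans (BK wP (@some_seed_incr N) (@seed_incr (N * L) k)).
  apply: le_Pr => // E [[j jN sj] sN].
  exists (E :&: inner c 0 (N * L)); first exact: finset.subsetIl.
  have jL : (j * L + L <= N * L)%N by rewrite addnC -mulSn leq_mul2r jN orbT.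
  split.
    exists j => //; apply: seed_incr (seed_inner _ sj); last by rewrite /L in jL; lia.
    by apply: finset.setIS; apply: inner_sub.
  apply: seed_incr (seed_inner NLk sN); apply/fintype.subsetP => e.
  rewrite !finset.in_setD !finset.in_setI => /andP[-> eN] /=; rewrite andbT.
  have dis := @inner_disj _ c n c_inj 0 (N * L) (N * L + L).
  have {}dis := dis ltac:(rewrite /L; lia) ltac:(lia).
  by apply/negP => e0; move/pred0P/(_ e): dis; rewrite /= e0 eN.
have u : Pr (ew p) (some_seed N.+1) = Pr (ew p) (fun E => some_seed N E \/ seed (N * L) k E).
  apply: eq_Pr => E; split => [[j]|[[j jN h]|h]].
  - by rewrite ltnS leq_eqVlt => /orP[/eqP ->|jN h]; [right|left; exists j].
  - by exists j => //; apply: ltnW.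
  - by exists N.
have s := PrU (ew p) (some_seed N) (seed (N * L) k).
have sp := Pr_seed NLk.
have l1 := Pr_le1 (seed (N * L) k) wP.
have l2 := Pr_le1 (some_seed N) wP.
rewrite exprSr; apply: le_trans (_ : _ <= (1 - Pr (ew p) (some_seed N)) * (1 - Pr (ew p) (seed (N * L) k))) _.
  by rewrite u; move: bk s; lra.
by apply: ler_pM; rewrite ?subr_ge0 // lerD2l lerN2.
Qed.

Definition full_contact N (E : {set {set 'I_n}}) : Prop := forall j v, (j < N)%N ->
  v \notin vs c (j * L) (j * L + L) ->
  (sigma <= nb_neighbors E v (vs c (j * L) (j * L + L)))%N.

Lemma full_contact_incr N : increasing (full_contact N).
Proof.
move=> E F EF h j v jN vj; apply: leq_trans (h j v jN vj) _.
exact: leq_nb_neighbors.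
Qed.

Lemma Pr_full_contact N : (N * L <= n)%N ->
  1 - Pr (ew p) (full_contact N) <= N%:R * (n%:R * (1 - phi sigma (q * (L - sigma)%:R))).
Proof.
move=> NL; rewrite -PrC.
pose D (i : nat * 'I_n) (E : {set {set 'I_n}}) := i.2 \notin vs c (i.1 * L) (i.1 * L + L) /\
  ~ (sigma <= nb_neighbors E i.2 (vs c (i.1 * L) (i.1 * L + L)))%N.
pose r := [seq (j, v) | j <- index_iota 0 N, v <- enum 'I_n].
apply: (@le_trans _ _ (\sum_(i <- r) Pr (ew p) (D i))).
  apply: le_trans (Pr_exists_le _ _ wP); apply: le_Pr => // E nfc.
  apply: contrapT => nD; apply: nfc => j v jN vj; apply: contrapT => h; apply: nD.
  exists (j, v); last by [].
  by apply/allpairsP; exists (j, v); rewrite mem_enum mem_index_iota jN.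
apply: (@le_trans _ _ (\sum_(i <- r) (1 - phi sigma (q * (L - sigma)%:R)))).
  rewrite ![\sum_(i <- r) _]big_seq; apply: ler_sum => i /allpairsP[[j v] [/= jN _ ->]].
  rewrite mem_index_iota in jN.
  have jL : (j * L + L <= N * L)%N by rewrite addnC -mulSn leq_mul2r; case/andP: jN => _ ->; rewrite orbT.
  have [vj|vj] := boolP (v \in vs c (j * L) (j * L + L)).
    rewrite -[leLHS](_ : Pr (ew p) (D (j, v)) = _) //.
    apply: le_trans (_ : 0 <= _); last by rewrite subr_ge0 phi_le1 // mulr_ge0 // ltW.
    rewrite -[leRHS](Ex_cst (@ew R 'I_n p)); apply: le_Ex => // E.
    by case: asboolP => // -[/=]; rewrite vj.
  apply: le_trans (_ : Pr (ew p) (fun E => ~ (sigma <= nb_neighbors E v (vs c (j * L) (j * L + L)))%N) <= _).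
    by apply: le_Pr => // E [].
  rewrite PrC lerD2l lerN2 Pr_nb_neighbors.
  have -> : vs c (j * L) (j * L + L) :\ v = vs c (j * L) (j * L + L).
    by apply/setP => w; rewrite finset.in_setD1; case: eqP => //= ->; rewrite (negbTE vj).
  rewrite (card_vs_eq c_inj); last by apply: leq_trans NL.
  by rewrite addKn; apply: phi_le_bin_tail => //; rewrite ltW.
rewrite big_const_seq count_predT iter_addr_0 size_allpairs size_enum_ord size_iota subn0.
by rewrite -[leLHS]mulr_natl natrM mulrA.
Qed.

Lemma some_seed_solve N E : (N * L <= n)%N -> some_seed N E -> full_contact N E -> slv E.
Proof.
move=> NL [j jN sj] fc.
have jL : (j * L + L <= N * L)%N by rewrite addnC -mulSn leq_mul2r jN orbT.
have vsE y : vs (ring_arc (c (j * L))) 0 y = vs c (j * L) (j * L + y).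
  apply/setP => v; apply/vsP/vsP => -[i ixy ->].
    by exists (j * L + i)%N; [lia|rewrite arcD].
  by exists (i - j * L)%N; [lia|rewrite arcD; congr ring_arc; lia].
apply: (@solve_of_seed n sigma E (c (j * L)) L).
- by rewrite /L in jL *; lia.
- move=> i iL; have := sj i iL; case: ifP => _ h.
    by left; rewrite /c !arcD.
  by right; rewrite vsE arcD.
- by move=> v; rewrite vsE; apply: fc.
Qed.

Lemma Pr_solve_ge (p' : R) N : (N * L <= n)%N -> p <= p' -> p' <= 1 ->
  1 - expR (- (N%:R * seed_prob)) - N%:R * (n%:R * (1 - phi sigma (q * (L - sigma)%:R))) <=
  Pr (ew p') (fun E => slv E).
Proof.
move=> NL pp' p'1.
have wP' : proba (@ew R 'I_n p') by apply: ew_proba; rewrite p'1 (le_trans (ltW p0)).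
pose A := fun E => some_seed N E /\ full_contact N E.
apply: le_trans (_ : Pr (ew p) A <= _); last first.
  apply: le_trans (_ : Pr (ew p') A <= _); last first.
    by apply: le_Pr => // E [sE fE]; apply: some_seed_solve NL sE fE.
  apply: Pr_homo_w => // [e|E F EF [h1 h2]]; first exact: ew_homo.
  by split; [apply: some_seed_incr h1|apply: full_contact_incr h2].
have h1 := Pr_some_seed NL; have h2 := Pr_full_contact NL.
have := PrU (ew p) (some_seed N) (full_contact N).
have := Pr_le1 (fun E => some_seed N E \/ full_contact N E) wP.
have h3 : (1 - seed_prob) ^+ N <= expR (- (N%:R * seed_prob)).
  have -> : - (N%:R * seed_prob) = N%:R * (- seed_prob) by rewrite mulrN.
  rewrite expRM_natl; apply: lerXn2r; rewrite ?nnegrE ?expR_ge0 //.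
    rewrite subr_ge0 /seed_prob mulr_ile1 ?exprn_ge0 ?expR_ge0 ?(ltW p0) //.
      by rewrite exprn_ile1 // ltW.
    by rewrite expR_le1 oppr_le0 divr_ge0 ?(ltW q0) // ltW // lam_gt0.
  exact: expR_ge1Dx.
by rewrite /A; lra.
Qed.

End RingBounds.

(** * Supercritical regime *)

Section Thresholds.
Variables (R : realType) (sigma : nat).
Hypothesis sigma1 : (1 <= sigma)%N.
Notation psolve n p := (solve_prob (ring_puzzle n) sigma 1 None (p : R)).
Notation lam := (lam R sigma).

Lemma solve_probE n (p : R) : psolve n p =
  Pr (ew (edge_prob p)) (fun E => solve (ring_puzzle n) sigma 1 None E).
Proof. exact: er_probE. Qed.

Lemma ln_linear (b y : R) : 0 < b -> 0 < y -> ln y <= b * y - ln b.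
Proof.
move=> b0 y0; rewrite lerBrDr -lnM ?posrE // mulrC; apply: ltW; apply: ln_sublinear.
by rewrite mulr_gt0.
Qed.

(** The last bound is of second order: it replaces [lam / q] by [lam / p] up to a bounded error. *)
Lemma rate_exists (p : R) : 0 < p -> p <= 2^-1 ->
  exists q : R, [/\ expR (- q) = 1 - p, 0 < q, p <= q, q <= 2 * p & p^-1 - 1 <= q^-1].
Proof.
move=> p0 p12; have p1 : 0 < 1 - p by lra.
have e : expR (- (- ln (1 - p))) = 1 - p by rewrite opprK lnK.
exists (- ln (1 - p)); have pq := rate_ge e.
have q0 : 0 < - ln (1 - p) by lra.
have qle : - ln (1 - p) <= p / (1 - p).
  rewrite -lnV ?posrE //; have := @le_ln1Dx R (p / (1 - p)).
  have -> : 1 + p / (1 - p) = (1 - p)^-1 by field; rewrite gt_eqF.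
  by apply; have : 0 < p / (1 - p); [rewrite divr_gt0|lra].
split=> //.
  apply: le_trans qle _; rewrite ler_pdivrMr //.
  have : 0 <= p * (1 - 2 * p) by apply: mulr_ge0; lra.
  by lra.
have -> : p^-1 - 1 = (p / (1 - p))^-1 by rewrite invf_div; field; rewrite gt_eqF.
by rewrite lef_pV2 ?posrE // divr_gt0.
Qed.

Lemma supercritical (eps eta : R) : 0 < eps -> 0 < eta -> exists x0 : R, forall n (p : R),
  x0 <= ln n%:R -> (1 + eps) * lam / ln n%:R <= p -> 1 - eta <= psolve n p.
Proof.
move=> eps0 eta0; have lam0 : 0 < lam by apply: lam_gt0.
pose c := (1 + eps) * lam; have c0 : 0 < c by rewrite mulr_gt0 //; lra.
(* With [n = expR x] and a seed cost of at most [expR (x / (1 + eps))], the gain is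
   [expR (kap * x)]. *)
pose kap := eps / (1 + eps); have kap0 : 0 < kap by rewrite divr_gt0 //; lra.
(* The term of degree [4 + sigma] of [expR (kap * x)] beats [x ^+ 3] from the block length and
   [x ^+ sigma] from [p0 ^+ sigma], leaving [C * x] as a lower bound for [N%:R * seed_prob]. *)
pose C := c ^+ sigma * kap ^+ (4 + sigma) / (4 * (4 + sigma)`!%:R).
have C0 : 0 < C.
  have f0 : 0 < (4 + sigma)`!%:R :> R by rewrite ltr0n fact_gt0.
  by rewrite /C divr_gt0 // mulr_gt0 // exprn_gt0.
pose tgt := ln (2 / eta).
(* The summands serve, in this order: [2 * L <= n], [p0 <= 2^-1], [sigma] small against [L], a
   contact mean of at least [6 * x], the seed error and the contact error, each at most
   [eta / 2]. *)
pose x0 := 96 + 2 * c + 2 * sigma%:R + 12 / c + `|tgt| / C + (`|tgt| + `|ln (2 ^+ sigma)|).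
exists x0 => n p; set x := ln n%:R => x0x cp.
have s0 : 0 <= sigma%:R :> R := ler0n R sigma.
have t0 : 0 <= `|tgt| / C by rewrite divr_ge0 // ltW.
have c12 : 0 <= 12 / c by rewrite divr_ge0 // ltW.
have nl0 : 0 <= `|ln (2 ^+ sigma)| :> R := normr_ge0 _.
have nt0 : 0 <= `|tgt| := normr_ge0 _.
have [x96 xc xs xt] : [/\ 96 <= x, 2 * c <= x, 2 * sigma%:R <= x & `|tgt| / C <= x].
  by rewrite /x0 in x0x; clear - x0x s0 t0 c12 nl0 nt0 c0; split; lra.
have [xc' xl] : 12 / c <= x /\ `|tgt| + `|ln (2 ^+ sigma)| <= x.
  by rewrite /x0 in x0x; clear - x0x s0 t0 c12 nl0 nt0 c0; split; lra.
have xp : 0 < x by lra.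
have n0 : 0 < n%:R :> R.
  rewrite lt0r ler0n andbT; apply/eqP => nE; move: xp; rewrite /x nE ln0 ?ltxx //.
have nE : n%:R = expR x :> R by rewrite /x lnK.
have n_gt0 : (0 < n)%N by rewrite -(ltr0n R).
pose p0 := c / x; have p00 : 0 < p0 by rewrite divr_gt0.
have p012 : p0 <= 2^-1 by rewrite ler_pdivrMr //; clear - xc; lra.
have [q [pq q0 p0q _ _]] := rate_exists p00 p012.
pose k := Num.truncn (x ^+ 3); pose L := k.+1; pose N := (n %/ L)%N.
have x3 : 0 <= x ^+ 3 by rewrite exprn_ge0 // ltW.
have Lge : x ^+ 3 <= L%:R by apply: ltW; exact: truncnS_gt.
have Lle : L%:R <= 2 * x ^+ 3.
  rewrite /L -natr1; have : k%:R <= x ^+ 3 by rewrite truncn_le.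
  have : 1 <= x ^+ 3 by rewrite exprn_ege1 //; clear - x96; lra.
  by clear; lra.
have nL : 2 * L%:R <= n%:R :> R.
  rewrite nE; have := exprn_le_expR 4 (ltW xp).
  have -> : (4`!)%:R = 24 :> R by [].
  have : 96 * x ^+ 3 <= x ^+ 4 by rewrite [x ^+ 4]exprS ler_wpM2r.
  by move=> h1 h2; clear - h1 h2 Lle; lra.
have NL : (N * L <= n)%N by apply: leq_trunc_div.
have Nge : n%:R <= 2 * N%:R * L%:R :> R.
  have : n%:R <= N%:R * L%:R + L%:R :> R.
    by rewrite -natrM -natrD ler_nat; have := ltn_ceil n (ltn0Sn k); rewrite mulSn addnC => /ltnW.
  by clear - nL; lra.
pose a : 'I_n := Ordinal n_gt0.
have p01 : p0 < 1 by clear - p012; lra.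
have ep := edge_prob01 p.
have epp : p0 <= edge_prob p.
  rewrite -[leLHS](edge_probE (p := p0)); last by rewrite !ltW.
  exact: edge_prob_homo.
have := @Pr_solve_ge R n sigma sigma1 a p0 q p00 p01 pq k (edge_prob p) N NL epp _.
rewrite -solve_probE; have /andP[_ ->] := ep => /(_ isT); apply: le_trans.
have etap : 0 < eta / 2 by clear - eta0; lra.
have tE : expR (- tgt) = eta / 2 by rewrite /tgt -lnV ?posrE ?divr_gt0 // invf_div lnK.
have h1 : expR (- (N%:R * seed_prob sigma p0 q)) <= eta / 2.
  rewrite -tE ler_expR lerN2; apply: le_trans (ler_norm _) _.
  apply: (@le_trans _ _ (C * x)); first by rewrite mulrC -ler_pdivrMr.
  have sb : p0 ^+ sigma * expR (- (x / (1 + eps))) <= seed_prob sigma p0 q.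
    rewrite /seed_prob; apply: ler_wpM2l; first by rewrite exprn_ge0 // ltW.
    rewrite ler_expR lerN2.
    have -> : x / (1 + eps) = lam / p0.
      by rewrite /p0 /c; field; rewrite !gt_eqF // addr_gt0.
    by apply: ler_wpM2l; [exact: ltW|rewrite lef_pV2 ?posrE].
  have sb0 : 0 <= p0 ^+ sigma * expR (- (x / (1 + eps))).
    by rewrite mulr_ge0 ?expR_ge0 // exprn_ge0 // ltW.
  have Nx : expR x <= N%:R * (4 * x ^+ 3).
    rewrite -nE; apply: le_trans Nge _.
    rewrite -mulrA mulrCA; apply: ler_wpM2l => //.
    by clear - Lle; lra.
  have x30 : 0 < 4 * x ^+ 3 by rewrite mulr_gt0 // exprn_gt0.
  rewrite -ler_pdivrMr // in Nx.
  apply: le_trans (ler_pM _ sb0 Nx sb); last by rewrite divr_ge0 ?expR_ge0 // ltW.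
  have -> : expR x / (4 * x ^+ 3) * (p0 ^+ sigma * expR (- (x / (1 + eps)))) =
     expR (kap * x) * (p0 ^+ sigma / (4 * x ^+ 3)).
    have -> : kap * x = x + - (x / (1 + eps)).
      by rewrite /kap; field; rewrite gt_eqF // addr_gt0.
    by rewrite expRD; ring.
  have kx : 0 <= kap * x by rewrite mulr_ge0 // ltW.
  have := exprn_le_expR (4 + sigma) kx.
  have f0 : 0 < (4 + sigma)`!%:R :> R by rewrite ltr0n fact_gt0.
  rewrite -ler_pdivrMl // => ek.
  apply: le_trans (ler_wpM2r _ ek); last first.
    by rewrite divr_ge0 ?exprn_ge0 // ltW.
  have alg (G y c' k' : R) : 0 < G -> 0 < y ->
      c' ^+ sigma * k' ^+ (4 + sigma) / (4 * G) * y =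
      G^-1 * (k' * y) ^+ (4 + sigma) * ((c' / y) ^+ sigma / (4 * y ^+ 3)).
    move=> G0 y0; rewrite !exprMn exprVn !exprD.
    by field; rewrite !gt_eqF // exprn_gt0.
  by rewrite /C /p0 alg.
have h2 : N%:R * (n%:R * (1 - phi sigma (q * (L - sigma)%:R))) <= eta / 2.
  have Nn : N%:R <= n%:R :> R by rewrite ler_nat leq_div.
  have sL : (sigma <= L)%N.
    rewrite -(ler_nat R); apply: le_trans Lge.
    have : x <= x ^+ 3 by rewrite -[leLHS]expr1 ler_weXn2l //; clear - x96; lra.
    by clear - xs s0; lra.
  have y0 : 0 <= q * (L - sigma)%:R by rewrite mulr_ge0 // ltW.
  have ph := phi_tail sigma y0.
  (* [phi_tail] halves the mean, and [expR (- (3 * x))] beats the at most [n * n] pairs of a block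
     and a vertex with a factor [expR (- x)] to spare. *)
  have yge : 6 * x <= q * (L - sigma)%:R.
    apply: le_trans (_ : p0 * (x ^+ 3 / 2) <= _).
      have -> : p0 * (x ^+ 3 / 2) = (c * x / 2) * x by rewrite /p0; field; rewrite gt_eqF.
      apply: ler_wpM2r; first exact: ltW.
      by move: xc'; rewrite ler_pdivrMr //; clear; lra.
    apply: ler_pM => //; [exact: ltW|by rewrite divr_ge0|].
    rewrite natrB //; have : 4 * sigma%:R <= x ^+ 3.
      have : x * 4 <= x ^+ 3.
        rewrite exprSr mulrC; apply: ler_wpM2r; first exact: ltW.
        by rewrite expr2; apply: le_trans (_ : 2 * 2 <= _); clear - x96; [lra|apply: ler_pM; lra].
      by clear - xs xp; lra.
    by clear - Lge x3; lra.
  apply: le_trans (_ : n%:R * (n%:R * (2 ^+ sigma * expR (- (3 * x)))) <= _).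
    apply: ler_pM => //.
      by rewrite mulr_ge0 // subr_ge0 phi_le1.
    apply: ler_wpM2l => //; apply: le_trans ph _; apply: ler_wpM2l; first by rewrite exprn_ge0.
    by rewrite ler_expR; clear - yge; lra.
  have -> : n%:R * (n%:R * (2 ^+ sigma * expR (- (3 * x)))) = expR (ln (2 ^+ sigma) - x).
    have two0 : 0 < 2 ^+ sigma :> R by rewrite exprn_gt0.
    rewrite nE (_ : ln (2 ^+ sigma) - x = x + (x + (ln (2 ^+ sigma) + - (3 * x)))); last by ring.
    by rewrite !expRD lnK.
  rewrite -tE ler_expR.
  have := ler_norm tgt; have := ler_norm (ln (2 ^+ sigma) : R); clear - xl; lra.
clear - h1 h2; lra.
Qed.

End Thresholds.

(** * Subcritical regime *)

Section Subcritical.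
Variables (R : realType) (sigma : nat).
Hypothesis sigma1 : (1 <= sigma)%N.
Notation psolve n p := (solve_prob (ring_puzzle n) sigma 1 None (p : R)).
Notation lam := (lam R sigma).

Lemma Pr_sp_exp_le (V : finType) (cc : nat -> V) (e1 h K d rho p q : R) k l :
  {in gtn (2 * k)%N &, injective cc} ->
  0 < e1 -> 0 < h -> h <= K -> 0 < K -> 0 < d -> d <= h / 2 -> rho = e1 / (4 * K) ->
  3 * d <= rho * phi sigma h ->
  (forall (q' d' : R) k', 0 < q' -> 0 <= d' -> q' + d' <= h -> K <= q' * k'%:R ->
     lam - e1 <= q' * \sum_(0 <= j < k') gr sigma (Num.max (q' * j.+1%:R + d') h)) ->
  0 < p -> p < 1 -> expR (- q) = 1 - p -> q <= h / 2 -> q <= K -> p <= d ->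
  K <= q * k%:R -> k%:R <= K / q + 1 -> q * l%:R <= d -> d / (2 * q) <= l%:R -> (0 < l)%N ->
  forall m, (k <= m < 2 * k)%N ->
  Pr (ew p) (fun E => sp sigma cc E 0 m) <=
  expR ((3 * ln (2 * k).+1%:R + gr sigma h) * (32 * K / d) - (lam - 2 * e1) / q).
Proof.
move=> inj e10 h0 hK K0 d0 dh rhoE dr approx p0 p1 pq qh qK pd kge kle lle lge l0 m /andP[km mk].
have q0 : 0 < q by apply: lt_le_trans (rate_ge pq).
have rho0 : 0 < rho by rewrite rhoE divr_gt0 // mulr_gt0.
have phih : 0 < phi sigma h by apply: phi_gt0.
have gh0 : 0 <= gr sigma h by apply: gr_ge0.
have max0 y : 0 < Num.max y h by rewrite lt_max h0 orbT.
(* The shift [d] covers the [l] lengths by which [m'] may exceed [u], as [q * l <= d]. The floor [h]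
   keeps the main term at least [phi sigma h], so the two corrections, at most [3 * d] together, are
   a relative error absorbed by [rho]; it also bounds [s 0]. *)
pose s u : R := gr sigma (Num.max (q * u.+1%:R + d) h) - rho.
have s_noninc u v : (u <= v)%N -> s v <= s u.
  move=> uv; rewrite /s lerD2r; apply: gr_noninc => //; rewrite ge_max !le_max lexx orbT andbT.
  by rewrite lerD2r ler_wpM2l ?(ltW q0) // ?ler_nat.
have gap m' u : (u < m')%N -> (m' <= u + l)%N -> (m' <= 2 * k)%N ->
    gap_cost sigma l p q m' <= expR (- s u).
  move=> um mul _; rewrite /s opprB expRD expR_gr //.
  set ps := phi _ (Num.max _ _).
  have psh : phi sigma h <= ps.
    by apply: phi_homo; [exact: ltW|rewrite le_max lexx orbT].
  have f1 : phi sigma (q * m'%:R) <= ps.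
    apply: phi_homo; first by rewrite mulr_ge0 // ltW.
    rewrite le_max; apply/orP; left.
    apply: le_trans (_ : q * (u + l)%:R <= _); first by rewrite ler_wpM2l ?(ltW q0) // ler_nat.
    rewrite natrD mulrDr; apply: lerD => //.
    by rewrite ler_wpM2l ?(ltW q0) // ler_nat.
  have f2 : phi sigma (q * (2 * l)%:R) <= 2 * d.
    rewrite -[X in phi X _](prednK sigma1).
    apply: le_trans (phiS_le_id _ _) _; first by rewrite mulr_ge0 // ltW.
    by rewrite natrM mulrCA ler_wpM2l.
  have f3 : ps + rho * ps <= expR rho * ps.
    rewrite -[X in X + _]mul1r -mulrDl; apply: ler_wpM2r; last exact: expR_ge1Dx.
    exact: le_trans (ltW phih) psh.
  have f4 : rho * phi sigma h <= rho * ps by rewrite ler_wpM2l // ltW.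
  by rewrite /gap_cost; clear - pd dr f1 f2 f3 f4; lra.
set al := 3 * ln _ + _.
have M1 : 1 <= (2 * k).+1%:R :> R by rewrite ler1n.
have M0 : 0 < (2 * k).+1%:R :> R by apply: lt_le_trans M1.
have lnM : 0 <= ln (2 * k).+1%:R :> R by rewrite ln_ge0.
have alM : (2 * k).+1%:R ^+ 3 <= expR al.
  rewrite -[leLHS]mulr1 expRD; apply: ler_pM => //.
    by rewrite (expRM_natl 3) lnK.
  by rewrite -[leLHS]expR0 ler_expR.
have als : s 0%N <= al.
  have : gr sigma (Num.max (q * 1 + d) h) <= gr sigma h.
    by apply: gr_noninc => //; rewrite le_max lexx orbT.
  by rewrite /s /al; clear - lnM rho0; lra.
have al0 : 0 <= al by rewrite /al addr_ge0 ?mulr_ge0.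
have m0 : (0 < m)%N.
  apply: leq_trans km; rewrite lt0n; apply/eqP => kE; move: kge.
  by rewrite kE mulr0 leNgt K0.
have l0R : 0 < l%:R :> R by rewrite ltr0n.
have Kq1 : 1 <= K / q by rewrite ler_pdivlMr // mul1r.
have mR : m%:R <= 2 * k%:R :> R by rewrite -natrM ler_nat ltnW.
have kR : k%:R <= m%:R :> R by rewrite ler_nat.
have := @Pr_sp_le R _ sigma cc (2 * k) l inj p q s al (ltW p0) p1 pq s_noninc gap alM als l0 0 m m0 (ltnW mk).
rewrite subn0 => /le_trans; apply.
rewrite ler_expR; apply: lerB.
  apply: ler_wpM2l => //; rewrite /node_count.
  (* From [m <= 2 * k <= 4 * K / q] and [d / (2 * q) <= l]: the bound no longer depends on [q]. *)
  have ml : 4 * m%:R / l%:R <= 32 * K / d.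
    rewrite ler_pdivrMr //.
    apply: le_trans (_ : 32 * K / d * (d / (2 * q)) <= _); last first.
      by apply: ler_wpM2l => //; rewrite divr_ge0 ?mulr_ge0 // ltW.
    have -> : 32 * K / d * (d / (2 * q)) = 16 * (K / q) by field; rewrite !gt_eqF.
    by clear - mR Kq1 kle; lra.
  rewrite ge_max; apply/andP; split; last by clear - ml; lra.
  apply: le_trans ml; rewrite ler_pdivlMr // mul1r.
  have lk : l%:R <= k%:R :> R.
    by rewrite -(ler_pM2l q0); clear - lle kge dh hK h0; lra.
  by clear - lk kR l0R; lra.
rewrite /slope_sum /s sumrB sumr_const_nat subn0 -[_ *+ m]mulr_natl.
have h1 : lam - e1 <= q * \sum_(0 <= j < k) gr sigma (Num.max (q * j.+1%:R + d) h).
  by apply: approx => //; [exact: ltW|clear - qh dh; lra].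
rewrite mulrC -ler_pdivrMr // in h1.
have h2 : \sum_(0 <= j < k) gr sigma (Num.max (q * j.+1%:R + d) h) <=
   \sum_(0 <= j < m) gr sigma (Num.max (q * j.+1%:R + d) h).
  rewrite [leRHS](@big_cat_nat _ _ _ k) //= lerDl sumr_ge0 // => j _; exact: gr_ge0.
(* [rho = e1 / (4 * K)] is chosen for this: at most [4 * K / q] slopes lose [e1 / q] in all.
   Truncation loses another [e1 / q], whence [2 * e1]. *)
have h3 : m%:R * rho <= e1 / q.
  apply: le_trans (_ : (4 * (K / q)) * rho <= _).
    by apply: ler_wpM2r; [exact: ltW|clear - mR Kq1 kle; lra].
  by rewrite rhoE le_eqVlt; apply/orP; left; apply/eqP; field; rewrite !gt_eqF.
have -> : (lam - 2 * e1) / q = (lam - e1) / q - e1 / q by field; rewrite gt_eqF.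
by clear - h1 h2 h3; lra.
Qed.

Lemma subcritical (eps eta : R) : 0 < eps -> eps < 1 -> 0 < eta -> exists x0 : R, forall n (p : R),
  x0 <= ln n%:R -> p <= (1 - eps) * lam / ln n%:R -> psolve n p <= eta.
Proof.
move=> eps0 eps1 eta0; have lam0 : 0 < lam by apply: lam_gt0.
pose c := (1 - eps) * lam; have c0 : 0 < c by rewrite mulr_gt0 //; lra.
(* The 8 makes [lam - 2 * e1] equal to [(1 - eps / 4) * lam], whose quotient by
   [c = (1 - eps) * lam] is [1 + kap]. *)
pose e1 := eps * lam / 8; have e10 : 0 < e1 by rewrite divr_gt0 // mulr_gt0.
have [h [K [h0 hK approx]]] := lam_approx sigma e10.
have K0 : 0 < K by lra.
pose rho := e1 / (4 * K); have rho0 : 0 < rho by rewrite divr_gt0 // mulr_gt0.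
have phih : 0 < phi sigma h by apply: phi_gt0.
pose d := Num.min (h / 2) (rho * phi sigma h / 3).
have d0 : 0 < d by rewrite lt_min; apply/andP; split; [lra|rewrite divr_gt0 // mulr_gt0].
have dh : d <= h / 2 by rewrite ge_min lexx.
have dr : 3 * d <= rho * phi sigma h.
  have : d <= rho * phi sigma h / 3 by rewrite ge_min lexx orbT.
  by lra.
pose CN := 32 * K / d; have CN0 : 0 < CN by rewrite divr_gt0 // mulr_gt0.
pose C := 2 * K / c + 3; have C0 : 0 < C by rewrite addr_gt0 // divr_gt0 // mulr_gt0.
pose kap := 3 / 4 * eps / (1 - eps).
have kap0 : 0 < kap by rewrite divr_gt0 ?mulr_gt0 //; lra.
(* [D] counts the logarithms of [C * x], a bound for the interval lengths: one for the factor [k] of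
   the union bound and three in each of [CN] payments of [alpha]. [b] is tuned so that together they
   cost [kap / 2 * x] plus a constant. *)
pose D := 1 + 3 * CN; have D0 : 0 < D by rewrite addr_gt0 // mulr_gt0.
pose b := kap / (2 * D * C); have b0 : 0 < b by rewrite divr_gt0 // mulr_gt0 // mulr_gt0.
pose cst := D * `|ln b| + gr sigma h * CN + lam + `|ln eta|.
pose t := Num.min d (Num.min (h / 2) K).
have t0 : 0 < t by rewrite lt_min d0 lt_min K0 andbT /=; lra.
have gh0 : 0 <= gr sigma h by apply: gr_ge0.
have cst0 : 0 <= cst.
  have z1 : 0 <= D * `|ln b| by apply: mulr_ge0; [exact: ltW|exact: normr_ge0].
  have z2 : 0 <= gr sigma h * CN by apply: mulr_ge0; [exact: gh0|exact: ltW].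
  have z3 : 0 <= `|ln eta| by exact: normr_ge0.
  by rewrite /cst; lra.
pose x0 := 1 + 2 * c + 4 * c / t + 2 * C + 2 * cst / kap.
exists x0 => n p; set x := ln n%:R => x0x pc.
have a1 : 0 <= 4 * c / t by apply: divr_ge0; [apply: mulr_ge0 => //; exact: ltW|exact: ltW].
have a2 : 0 <= 2 * cst / kap by apply: divr_ge0; [exact: mulr_ge0|exact: ltW].
have [x1 xc xt xC] : [/\ 1 <= x, 2 * c <= x, 4 * c / t <= x & 2 * C <= x].
  by rewrite /x0 in x0x; clear - x0x a1 a2 c0 C0; split; lra.
have xk : 2 * cst / kap <= x by rewrite /x0 in x0x; clear - x0x a1 a2 c0 C0; lra.
have xp : 0 < x by lra.
have n0 : 0 < n%:R :> R.
  rewrite lt0r ler0n andbT; apply/eqP => nE; move: xp; rewrite /x nE ln0 ?ltxx //.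
have nE : n%:R = expR x :> R by rewrite /x lnK.
pose p0 := c / x; have p00 : 0 < p0 by rewrite divr_gt0.
have p012 : p0 <= 2^-1 by rewrite ler_pdivrMr // ; lra.
have [q [pq q0 p0q q2p qinv]] := rate_exists p00 p012.
have qt : 2 * q <= t.
  apply: le_trans (_ : 4 * p0 <= _); first lra.
  by rewrite /p0 mulrA ler_pdivrMr // [t * x]mulrC -ler_pdivrMr.
have td : t <= d by rewrite ge_min lexx.
have th : t <= h / 2 by rewrite /t !ge_min lexx orbT.
have tK : t <= K by rewrite !ge_min lexx !orbT.
pose k := (Num.truncn (K / q)).+1; pose l := Num.truncn (d / q); pose M := (2 * k)%N.
have Kq : 0 < K / q by rewrite divr_gt0.
have dq : 0 < d / q by rewrite divr_gt0.
have kge : K <= q * k%:R by rewrite mulrC -ler_pdivrMr //; apply: ltW; apply: truncnS_gt.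
have kle : k%:R <= K / q + 1 by rewrite -natr1 lerD2r truncn_le // ltW.
have lle : q * l%:R <= d by rewrite mulrC -ler_pdivlMr // truncn_le // ltW.
have lge : d / (2 * q) <= l%:R.
  have : d / q < l%:R + 1 by rewrite natr1; apply: truncnS_gt.
  have : 2 * 1 <= d / q by rewrite mulr1 ler_pdivlMr //; clear - qt td; lra.
  have -> : d / (2 * q) = d / q / 2 by field; rewrite gt_eqF.
  by clear - dq; lra.
have l0R : 0 < l%:R :> R by apply: lt_le_trans lge; rewrite divr_gt0 // mulr_gt0.
have l0 : (0 < l)%N by rewrite -(ltr0n R).
have ME : M%:R = 2 * k%:R :> R by rewrite /M natrM.
have MC : M.+1%:R <= C * x.
  have : K / q <= K / c * x.
    have -> : K / c * x = K / p0 by rewrite /p0; field; rewrite !gt_eqF.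
    by rewrite ler_pM2l // lef_pV2 ?posrE.
  have -> : C * x = 2 * (K / c * x) + 3 * x by rewrite /C; ring.
  by rewrite -natr1 ME; move: kle; clear - x1; lra.
have Mn : (M <= n)%N.
  rewrite -(ler_nat R) nE; apply: le_trans (_ : C * x <= _); first by move: MC; rewrite -natr1; clear; lra.
  have := exprn_le_expR 2 (ltW xp).
  have -> : (2`!)%:R = 2 :> R by [].
  have : 2 * C * x <= x ^+ 2 by rewrite expr2 ler_wpM2r // ltW.
  by clear - xp; lra.
have k2 : (2 <= k)%N.
  rewrite ltnS lt0n; apply/eqP => e; have := truncnS_gt (K / q); rewrite e ltr_pdivrMr //.
  by clear - tK qt q0; lra.
have p01 : p0 < 1 by clear - p012; lra.
pose al := 3 * ln M.+1%:R + gr sigma h.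
have M1 : 1 <= M.+1%:R :> R by rewrite ler1n.
have M0 : 0 < M.+1%:R :> R by apply: lt_le_trans M1.
have lnM : 0 <= ln M.+1%:R :> R by rewrite ln_ge0.
pose B := expR (al * CN - (lam - 2 * e1) / q).
have ep := edge_prob01 p.
have epp : edge_prob p <= p0.
  rewrite -[leRHS](edge_probE (p := p0)); last by rewrite !ltW.
  exact: edge_prob_homo.
have spB (a : 'I_n) m : (k <= m < 2 * k)%N ->
    Pr (ew p0) (fun E => sp sigma (ring_arc a) E 0 m) <= B.
  apply: (Pr_sp_exp_le (l := l) (rho := rho)) => //.
  - by move=> i j iM jM; apply: arc_inj; rewrite inE in iM jM *; apply: leq_trans Mn.
  - exact: ltW.
  - by clear - qt th q0; lra.
  - by clear - qt tK q0; lra.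
  - by clear - qt td q0 p0q; lra.
have /andP[ep0 _] := ep.
have := Pr_solve_le sigma1 ep0 epp (ltW p01) k2 Mn spB.
rewrite -solve_probE => /le_trans; apply.
have kC : k%:R <= C * x by move: MC; rewrite -natr1 ME; have := ler0n R k; clear; lra.
have Cx0 : 0 < C * x by rewrite mulr_gt0.
have lnb := ln_linear b0 Cx0.
apply: le_trans (_ : expR x * (expR (ln (C * x)) * B) <= _).
  rewrite nE; apply: ler_wpM2l; first exact: expR_ge0.
  by apply: ler_wpM2r; [exact: expR_ge0|rewrite lnK].
rewrite /B -!expRD -[leRHS]lnK ?posrE // ler_expR.
have lnMC : ln M.+1%:R <= ln (C * x) by rewrite ler_ln ?posrE.
have g1 : al * CN <= (3 * ln (C * x) + gr sigma h) * CN.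
  by apply: ler_wpM2r; [exact: ltW|rewrite /al; clear - lnMC; lra].
have g2 : (1 + kap) * x - lam <= (lam - 2 * e1) / q.
  have le0 : 0 <= lam - 2 * e1.
    have : 0 <= lam * (1 - eps) by apply: mulr_ge0; [exact: ltW|clear - eps1; lra].
    by rewrite /e1; clear - lam0; lra.
  apply: le_trans (_ : (lam - 2 * e1) * (p0^-1 - 1) <= _); last first.
    by apply: ler_wpM2l.
  have -> : (lam - 2 * e1) * (p0^-1 - 1) = (1 + kap) * x - (lam - 2 * e1).
    by rewrite /p0 /c /kap /e1; field; rewrite !gt_eqF // subr_gt0.
  by rewrite /e1; clear - eps0 lam0; have := mulr_gt0 eps0 lam0; lra.
have g3 : D * ln (C * x) <= kap / 2 * x + D * `|ln b|.
  apply: le_trans (ler_wpM2l (ltW D0) lnb) _.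
  have -> : D * (b * (C * x) - ln b) = kap / 2 * x + D * - ln b.
    by rewrite /b; field; rewrite !gt_eqF.
  by rewrite lerD2l ler_wpM2l ?(ltW D0) // -normrN ler_norm.
have g4 : cst <= kap / 2 * x.
  by move: xk; rewrite ler_pdivrMr //; clear - kap0; lra.
have g5 : - `|ln eta| <= ln eta by rewrite lerNl -normrN ler_norm.
rewrite /cst in g4; rewrite /D in g3 g4.
by clear - g1 g2 g3 g4 g5; lra.
Qed.

End Subcritical.

Local Open Scope classical_set_scope.
Local Open Scope ring_scope.

(** * Location of the critical probability *)

Section CriticalProb.
Variables (R : realType) (sigma : nat).
Hypothesis sigma1 : (1 <= sigma)%N.
Notation psolve n p := (solve_prob (ring_puzzle n) sigma 1 None (p : R)).
Notation pc n := (critical_prob R (ring_puzzle n) sigma 1 None).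
Notation lam := (lam R sigma).

(** Supplies the continuity behind the existence of a critical value, through the intermediate value
    theorem for polynomials. *)
Lemma solve_prob_poly n : exists P : {poly R}, forall p : R, 0 <= p <= 1 -> psolve n p = P.[p].
Proof.
exists (\sum_(E : {set {set 'I_n}})
   (\prod_e (if e \in E then (if e \in pairs 'I_n then 'X else 0)
             else 1 - (if e \in pairs 'I_n then 'X else 0))) *
    (`[< solve (ring_puzzle n) sigma 1 None E >])%:R%:P).
move=> p p01; rewrite solve_probE edge_probE // horner_sum; apply: eq_bigr => E _.
rewrite hornerM hornerC; congr (_ * _); rewrite horner_prod; apply: eq_bigr => e _.
by rewrite /ew; case: ifP => _; case: ifP => _; rewrite !hornerE.
Qed.

Lemma critical_probP n : psolve n 0 <= 2^-1 -> 2^-1 <= psolve n 1 ->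
  0 <= pc n <= 1 /\ psolve n (pc n) = 2^-1.
Proof.
move=> h0 h1; rewrite /critical_prob.
apply: (@xgetPex _ 0 [set p : R | 0 <= p <= 1 /\ psolve n p = 2^-1]).
have [P PE] := solve_prob_poly n.
have [|p p01] := @poly_ivt R (P - 2^-1%:P) 0 1 ler01.
  by rewrite !hornerE -!PE ?lexx ?ler01 // subr_le0 subr_ge0 h0.
rewrite /root !hornerE subr_eq0 => /eqP Pp.
by exists p; rewrite /= p01 PE.
Qed.

Lemma near_ln (A : R) : \forall n \near \oo, A <= ln n%:R.
Proof.
exists (Num.truncn (expR A)).+1 => // n /= nA.
have h : expR A <= n%:R by apply: ltW; apply: lt_le_trans (truncnS_gt _) _; rewrite ler_nat.
by rewrite -ler_expR lnK // posrE; apply: lt_le_trans h; apply: expR_gt0.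
Qed.

(** At 0 and 1 the two regimes give values on either side of 1/2, so a critical value exists;
    outside the window they exclude the value 1/2, which confines it. *)
Lemma near_critical (eps : R) : 0 < eps -> eps < 1 -> \forall n \near \oo,
  0 < ln (n%:R : R) /\ (1 - eps) * lam / ln n%:R <= pc n <= (1 + eps) * lam / ln n%:R.
Proof.
move=> eps0 eps1; have lam0 := @lam_gt0 R sigma sigma1.
have q0 : 0 < 4^-1 :> R by rewrite invr_gt0.
have [x1 super] := supercritical sigma1 eps0 q0.
have [x2 sub] := subcritical sigma1 eps0 eps1 q0.
near=> n.
have lnn : 0 < ln n%:R :> R.
  by apply: lt_le_trans (ltr01) _; near: n; apply: near_ln.
have n1 : x1 <= ln n%:R by near: n; apply: near_ln.
have n2 : x2 <= ln n%:R by near: n; apply: near_ln.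
have n3 : (1 + eps) * lam <= ln n%:R by near: n; apply: near_ln.
have s0 : psolve n 0 <= 4^-1.
  by apply: sub => //; rewrite !mulr_ge0 ?invr_ge0 ?(ltW lam0) ?(ltW lnn) // subr_ge0 ltW.
have s1 : 1 - 4^-1 <= psolve n 1.
  by apply: super => //; rewrite ler_pdivrMr // mul1r.
have [||p01 ph] := @critical_probP n; [lra|lra|].
split=> //; apply/andP; split; rewrite leNgt; apply/negP => h.
  by have := sub n _ n2 (ltW h); rewrite ph; lra.
by have := super n _ n1 (ltW h); rewrite ph; lra.
Unshelve. all: by end_near. Qed.

End CriticalProb.

Theorem theorem4 (R : realType) (sigma : nat) (sigma_ge1 : (1 <= sigma)%N) :
  ((critical_prob R (ring_puzzle n) sigma 1 None * ln n%:R)%:E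
     @[n --> \oo] --> lambda_ R sigma) /\
  sharp_transition R ring_puzzle sigma 1 None.
Proof.
have lam0 := @lam_gt0 R sigma sigma_ge1.
split.
  rewrite (lambdaE R sigma); apply: cvg_EFin; first by apply: nearW => n.
  apply/cvgrPdist_le => e e0 /=.
  pose d := Num.min (2^-1) (e / lam R sigma).
  have d0 : 0 < d by rewrite lt_min invr_gt0 ltr0n divr_gt0.
  have d1 : d < 1 by apply: le_lt_trans (_ : 2^-1 < 1); [rewrite ge_min lexx|lra].
  have de : d * lam R sigma <= e by rewrite -ler_pdivlMr // ge_min lexx orbT.
  near=> n.
  have [lnn /andP[h1 h2]] : 0 < ln (n%:R : R) /\ (1 - d) * lam R sigma / ln n%:R <=
      critical_prob R (ring_puzzle n) sigma 1 None <= (1 + d) * lam R sigma / ln n%:R.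
    by near: n; apply: near_critical.
  rewrite ler_pdivrMr // in h1; rewrite ler_pdivlMr // in h2.
  by rewrite ler_distl; apply/andP; split; lra.
pose pc n := critical_prob R (ring_puzzle n) sigma 1 None.
move=> eps eps0; split.
  apply/cvgrPdist_le => e e0 /=.
  (* For [eps < 1], [d <= eps / 2] yields [(1 - eps) * (1 + d) <= 1 - d], which puts the argument in
     the subcritical range at [d]. *)
  pose d := Num.min 1 eps / 2.
  have d0 : 0 < d by rewrite divr_gt0 // lt_min ltr01.
  have d1 : d <= 2^-1 by rewrite /d ler_pdivrMr // mulVf ?pnatr_eq0 // ge_min lexx.
  have de : d <= eps / 2 by rewrite /d ler_pM2r ?invr_gt0 // ge_min lexx orbT.
  have d1' : d < 1 by lra.
  have [x0 sub] := subcritical sigma_ge1 d0 d1' e0.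
  near=> n.
  have [lnn /andP[h1 h2]] : 0 < ln (n%:R : R) /\ (1 - d) * lam R sigma / ln n%:R <=
      pc n <= (1 + d) * lam R sigma / ln n%:R.
    by near: n; apply: near_critical.
  rewrite sub0r normrN ger0_norm; last first.
    by rewrite solve_probE Pr_ge0 //; apply: ew_proba; apply: edge_prob01.
  apply: sub; first by near: n; apply: near_ln.
  rewrite -mulrA in h1; rewrite -mulrA in h2; set y := lam R sigma / _ in h1 h2.
  rewrite -[X in _ <= X]mulrA -/y.
  have y0 : 0 < y by rewrite divr_gt0.
  (* For [eps >= 1] the factor [1 - eps] is nonpositive and would reverse the bounds on [pc n]; the
     sign alone puts the argument below the threshold. *)
  have [e1|e1] := leP 1 eps.
    apply: (@le_trans _ _ 0); last by rewrite mulr_ge0 ?(ltW y0) //; lra.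
    rewrite mulr_le0_ge0 //; first lra.
    by apply: le_trans h1; rewrite mulr_ge0 ?(ltW y0) //; lra.
  apply: (@le_trans _ _ ((1 - eps) * ((1 + d) * y))); first by rewrite ler_wpM2l // subr_ge0 ltW.
  rewrite mulrA; apply: ler_wpM2r; first exact: ltW.
  by have := mulr_gt0 eps0 d0; lra.
apply/cvgrPdist_le => e e0 /=.
(* The supercritical estimate is applied at [eps / 2]: the bounds [d <= 4^-1] and [d <= eps / 4]
   give [(1 + eps) * (1 - d) >= 1 + eps / 2]. *)
pose d := Num.min 1 eps / 4.
have d0 : 0 < d by rewrite divr_gt0 // lt_min ltr01.
have d1 : d <= 4^-1 by rewrite /d ler_pdivrMr // mulVf ?pnatr_eq0 // ge_min lexx.
have de : d <= eps / 4 by rewrite /d ler_pM2r ?invr_gt0 // ge_min lexx orbT.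
have d1' : d < 1 by lra.
have [x0 super] := supercritical sigma_ge1 (divr_gt0 eps0 (ltr0Sn R 1)) e0.
near=> n.
have [lnn /andP[h1 h2]] : 0 < ln (n%:R : R) /\ (1 - d) * lam R sigma / ln n%:R <=
    pc n <= (1 + d) * lam R sigma / ln n%:R.
  by near: n; apply: near_critical.
rewrite ger0_norm; last first.
  by rewrite subr_ge0 solve_probE Pr_le1 //; apply: ew_proba; apply: edge_prob01.
rewrite lerBlDr -lerBlDl; apply: super; first by near: n; apply: near_ln.
rewrite -mulrA in h1; rewrite -mulrA in h2; set y := lam R sigma / _ in h1 h2.
rewrite -[X in X <= _]mulrA -/y.
have y0 : 0 < y by rewrite divr_gt0.
apply: (@le_trans _ _ ((1 + eps) * ((1 - d) * y))); last by rewrite ler_wpM2l //; lra.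
rewrite [leRHS]mulrA; apply: ler_wpM2r; first exact: ltW.
have : eps * d <= eps * 4^-1 by rewrite ler_wpM2l // ltW.
by lra.
Unshelve. all: by end_near. Qed.
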